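(* Let $X_1=X_2=X_3=[0,1]$, each $\mu_{ij}$ Lebesgue measure on $[0,1]^2$, and $c=x_1x_2x_3$. Suppose $f_{12},f_{13},f_{23}:[0,1]^2\to\mathbb{R}$ are continuous, satisfy $f_{12}(x_1,x_2)+f_{13}(x_1,x_3)+f_{23}(x_2,x_3)\le x_1x_2x_3$ for all $(x_1,x_2,x_3)\in[0,1]^3$, and maximize $\sum_{i<j}\int_{[0,1]^2}f_{ij}\,dx_i\,dx_j$ among all tuples of integrable functions satisfying this inequality. Then there exist continuous functions $f_1,f_2,f_3:[0,1]\to\mathbb{R}$ such that $f_{12}(x_1,x_2)=f(x_1,x_2)+f_1(x_1)-f_2(x_2)$, $f_{23}(x_2,x_3)=f(x_2,x_3)+f_2(x_2)-f_3(x_3)$, $f_{13}(x_1,x_3)=f(x_1,x_3)+f_3(x_3)-f_1(x_1)$, where $$f(x,y)=\int_0^x\!\!\int_0^y s\oplus t\,ds\,dt-\frac14\int_0^x\!\!\int_0^x s\oplus t\,ds\,dt-\frac14\int_0^y\!\!\int_0^y s\oplus t\,ds\,dt.$$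
   Context: For $x,y\in[0,1]$, $x\oplus y$ is the bitwise XOR of binary expansions: write $x=\overline{0.x_1x_2\dots}_2$, $y=\overline{0.y_1y_2\dots}_2$, using for dyadic rationals less than $1$ the expansion with finitely many ones and for $1$ the expansion $0.111\dots$; then $x\oplus y=\overline{0.(x_1\oplus y_1)(x_2\oplus y_2)\dots}_2$ with $\oplus$ addition mod $2$ on digits. *)

(* Defs.v *)
From HB Require Import structures.
From mathcomp Require Import all_boot all_order all_algebra.
From mathcomp Require Import all_classical all_reals all_analysis.
Set Implicit Arguments. Unset Strict Implicit. Unset Printing Implicit Defensive.
Import Order.TTheory GRing.Theory Num.Theory.
Import numFieldNormedType.Exports.
Local Open Scope classical_set_scope.
Local Open Scope ring_scope.

Section XorDefs.
Variable R : realType.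

(* n-th binary digit (n = 0 is the first digit after the point) of x in [0,1],
   using the finite expansion for dyadic rationals < 1 and 0.111... for 1. *)
Definition bdigit (x : R) (n : nat) : bool :=
  if x == 1 then true else odd (Num.truncn (2 ^+ n.+1 * x)).

Definition xorR (x y : R) : R :=
  limn (series (fun n : nat => ((bdigit x n (+) bdigit y n)%:R / 2 ^+ n.+1 : R))).

Definition Ixor (x y : R) : R :=
  fine (\int[@lebesgue_measure R]_(t in `[0%R, x]%classic)
          (\int[@lebesgue_measure R]_(s in `[0%R, y]%classic) (xorR s t)%:E))%E.

Definition fxor (x y : R) : R :=
  Ixor x y - 4^-1 * Ixor x x - 4^-1 * Ixor y y.

End XorDefs.

Definition leb2 (R : realType) :=
  ((@lebesgue_measure R) \x (@lebesgue_measure R))%E.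

Definition unit_sq (R : realType) : set (R * R) := `[(0:R), 1] `*` `[(0:R), 1].
Arguments unit_sq R : clear implicits.
Arguments leb2 R : clear implicits.

(* Main.v *)
(* The measure that is uniform on the closure T of the graph z = x xor y projects to
   Lebesgue measure on each pair of coordinates, and the triple made of fxor is feasible
   with equality on T.  Hence an optimal continuous triple has zero gap
   x1 x2 x3 - f12 - f13 - f23 on T; everything is done on dyadic grids, where averages over
   the grid points of T are sums of three Riemann sums.

   Over a dyadic square with sides [x, x+h] and [y, y+h], the set T passes through the
   vertices (x,y,z), (x+h,y+h,z), (x+h,y,z+h), (x,y+h,z+h) of a tetrahedron.  Equality at
   the vertices and the constraint at the other corners of the cube force the mixed
   difference of f12 over the square into [z h^2, (z+h) h^2].  These bounds determine
   f12 up to functions of one variable, and Ixor satisfies them too.  The equalities at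
   (0,t,t), (t,0,t), (t,t,0), which also lie in T, then identify the one-variable terms. *)
Require Import Defs.
From Stdlib Require Import PeanoNat.
From HB Require Import structures.
From mathcomp Require Import all_boot all_order all_algebra.
From mathcomp Require Import ring lra zify.
From mathcomp Require Import all_classical all_reals all_analysis.
From mathcomp Require Import measurable_realfun.
Import Order.TTheory GRing.Theory Num.Theory.
Import numFieldNormedType.Exports.
Local Open Scope classical_set_scope.
Local Open Scope ring_scope.

Local Notation lxor := Nat.lxor.

(** * Bitwise xor of natural numbers and the splitting of binary expansions *)

Section NatXor.
Local Open Scope nat_scope.

Lemma expn2E n : 2 ^ n = Nat.pow 2 n.
Proof. by elim: n => // n IH; rewrite expnS IH /= mul2n -addnn; lia. Qed.

Lemma testbit_ge r d m : d < 2 ^ r -> r <= m -> Nat.testbit d m = false.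
Proof.
rewrite expn2E => /ssrnat.ltP dr /ssrnat.leP rm.
by rewrite -(Nat.mod_small _ _ dr) Nat.mod_pow2_bits_high.
Qed.

Lemma lxor_lt r a b : a < 2 ^ r -> b < 2 ^ r -> lxor a b < 2 ^ r.
Proof.
move=> ar br.
(* Neither argument has a bit from position [r] on, so reduction modulo [2 ^ r] fixes the xor, and a
   remainder is below its modulus. *)
have <- : Nat.modulo (lxor a b) (Nat.pow 2 r) = lxor a b.
  apply: Nat.bits_inj => m.
  case: (leqP r m) => rm.
    rewrite Nat.mod_pow2_bits_high; last exact/ssrnat.leP.
    by rewrite Nat.lxor_spec !(@testbit_ge r).
  by rewrite Nat.mod_pow2_bits_low//; apply/ssrnat.ltP.
rewrite expn2E; apply/ssrnat.ltP; apply: Nat.mod_upper_bound.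
by apply: Nat.pow_nonzero.
Qed.

(** The summands share no bit position, so the addition has no carries and coincides with xor. *)
Lemma shiftl_addE r a d : d < 2 ^ r -> a * 2 ^ r + d = lxor (Nat.shiftl a r) d.
Proof.
move=> dr; rewrite Nat.shiftl_mul_pow2 -expn2E -Nat.add_nocarry_lxor //.
rewrite [X in Nat.land X _](_ : _ = Nat.shiftl a r); last first.
  by rewrite Nat.shiftl_mul_pow2 -expn2E.
apply: Nat.bits_inj => m; rewrite Nat.land_spec Nat.bits_0.
case: (leqP r m) => rm; first by rewrite (testbit_ge _ _ _ dr rm) andbF.
by rewrite Nat.shiftl_spec_low//; apply/ssrnat.ltP.
Qed.

Lemma lxor_split r a b a' b' : a' < 2 ^ r -> b' < 2 ^ r ->
  lxor (a * 2 ^ r + a') (b * 2 ^ r + b') = lxor a b * 2 ^ r + lxor a' b'.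
Proof.
move=> ar br; rewrite !shiftl_addE ?lxor_lt// Nat.shiftl_lxor.
rewrite -!Nat.lxor_assoc; congr Nat.lxor; rewrite !Nat.lxor_assoc.
by congr Nat.lxor; rewrite Nat.lxor_comm.
Qed.

Lemma lxorK i j : lxor i (lxor i j) = j.
Proof. by rewrite -Nat.lxor_assoc Nat.lxor_nilpotent Nat.lxor_0_l. Qed.

Lemma lxorKr i j : lxor (lxor j i) i = j.
Proof. by rewrite Nat.lxor_assoc Nat.lxor_nilpotent Nat.lxor_0_r. Qed.

Lemma lxor_topl n i j : i < 2 ^ n -> j < 2 ^ n ->
  lxor (2 ^ n + i) j = 2 ^ n + lxor i j.
Proof.
move=> ni nj; have := lxor_split n 1 0 i j ni nj.
by rewrite Nat.lxor_0_r mul1n mul0n add0n.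
Qed.

Lemma lxor_topr n i j : i < 2 ^ n -> j < 2 ^ n ->
  lxor i (2 ^ n + j) = 2 ^ n + lxor i j.
Proof. by move=> ni nj; rewrite Nat.lxor_comm lxor_topl// Nat.lxor_comm. Qed.

Lemma lxor_top n i j : i < 2 ^ n -> j < 2 ^ n ->
  lxor (2 ^ n + i) (2 ^ n + j) = lxor i j.
Proof.
move=> ni nj; have := lxor_split n 1 1 i j ni nj.
by rewrite Nat.lxor_nilpotent mul1n mul0n add0n.
Qed.

End NatXor.

Section XorDuality.
Variable R : realType.

(** * Sums of xor over integer rectangles and their dyadic recursions *)

Section XorSums.

(** The map [i -> lxor i j] is an involution of the integers below [2 ^ n], so it only permutes the
    summands. *)
Lemma sum_lxor n j (F : nat -> R) : (j < 2 ^ n)%N ->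
  \sum_(0 <= i < 2 ^ n) F (lxor i j) = \sum_(0 <= i < 2 ^ n) F i.
Proof.
move=> jn; rewrite !big_mkord.
pose h (i : 'I_(2 ^ n)) := Ordinal (lxor_lt n i j (ltn_ord i) jn).
rewrite [RHS](reindex_inj (h := h))//.
by move=> a b [] /(congr1 (fun x => lxor x j)); rewrite !lxorKr => /val_inj.
Qed.

(* A dyadic cell contributes its lower corner i xor j plus 1/2: the average of xor over
   a cell, in units of the mesh. *)
Definition xor_sum (a b : nat) : R :=
  \sum_(0 <= i < a) \sum_(0 <= j < b) ((lxor i j)%:R + 2^-1).

Lemma xor_sumC a b : xor_sum a b = xor_sum b a.
Proof.
rewrite /xor_sum exchange_big /=; apply: eq_bigr => i _; apply: eq_bigr => j _.
by rewrite Nat.lxor_comm.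
Qed.

Lemma xor_sum0l b : xor_sum 0 b = 0. Proof. by rewrite /xor_sum big_nil. Qed.
Lemma xor_sum0r b : xor_sum b 0 = 0. Proof. by rewrite xor_sumC xor_sum0l. Qed.

Lemma sum_id_half m : \sum_(0 <= i < m) (i%:R + 2^-1) = m%:R ^+ 2 / 2 :> R.
Proof.
elim: m => [|m IH]; first by rewrite big_nil mulr0n; ring.
by rewrite big_nat_recr//= IH -natr1; field.
Qed.

(** In each column [lxor i j] runs once through the integers below [N = 2 ^ n], and the added halves
    make the column sum exactly [N ^ 2 / 2]. *)
Lemma xor_sum_full n b : (b <= 2 ^ n)%N -> xor_sum (2 ^ n) b = b%:R * (2 ^ n)%:R ^+ 2 / 2.
Proof.
move=> bn; rewrite /xor_sum exchange_big /=.
rewrite (eq_big_nat _ _ (F2 := fun=> (2 ^ n)%:R ^+ 2 / 2)); last first.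
  move=> i /andP[_ ib].
  rewrite (sum_lxor n i (fun k => k%:R + 2^-1)) ?sum_id_half//.
  exact: leq_trans ib bn.
by rewrite sumr_const_nat subn0 -[LHS]mulr_natl mulrA.
Qed.

Lemma sum_split (F : nat -> R) m a :
  \sum_(0 <= i < m + a) F i = \sum_(0 <= i < m) F i + \sum_(0 <= i < a) F (m + i)%N.
Proof.
rewrite (@big_cat_nat _ _ _ m)//= ?leq_addr//; congr (_ + _).
by rewrite -{1}(add0n m) big_addn addKn; apply: eq_bigr => i _; rewrite addnC.
Qed.

Lemma xor_sum_block n a b : (a <= 2 ^ n)%N -> (b <= 2 ^ n)%N ->
  \sum_(0 <= i < a) \sum_(0 <= j < b) ((lxor (2 ^ n + i) j)%:R + 2^-1)
  = xor_sum a b + a%:R * b%:R * (2 ^ n)%:R :> R.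
Proof.
move=> an bn.
rewrite (eq_big_nat _ _ (F2 := fun i =>
  (\sum_(0 <= j < b) ((lxor i j)%:R + 2^-1)) + b%:R * (2 ^ n)%:R)); last first.
  move=> i /andP[_ ia].
  rewrite (eq_big_nat _ _ (F2 := fun j => ((lxor i j)%:R + 2^-1) + (2 ^ n)%:R)); last first.
    move=> j /andP[_ jb].
    rewrite lxor_topl ?(leq_trans ia)// ?(leq_trans jb)// natrD; ring.
  by rewrite big_split /= sumr_const_nat subn0 [in RHS]mulr_natl.
rewrite big_split /= sumr_const_nat subn0; congr (_ + _).
by rewrite -[LHS]mulr_natl mulrA.
Qed.

Lemma xor_sum_topl n a b : (a <= 2 ^ n)%N -> (b <= 2 ^ n)%N ->
  xor_sum (2 ^ n + a) b = xor_sum a b + a%:R * b%:R * (2 ^ n)%:R + b%:R * (2 ^ n)%:R ^+ 2 / 2.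
Proof.
move=> an bn; rewrite {1}/xor_sum sum_split xor_sum_block// -/(xor_sum _ b).
by rewrite xor_sum_full// addrC.
Qed.

Lemma xor_sum_topr n a b : (a <= 2 ^ n)%N -> (b <= 2 ^ n)%N ->
  xor_sum a (2 ^ n + b) = xor_sum a b + a%:R * b%:R * (2 ^ n)%:R + a%:R * (2 ^ n)%:R ^+ 2 / 2.
Proof. by move=> an bn; rewrite xor_sumC xor_sum_topl// xor_sumC (mulrC b%:R). Qed.

(** There are four blocks: the full square of side [2 ^ n], two strips in which one index carries
    the top bit, and a corner where the two top bits cancel and [xor_sum a b] remains. *)
Lemma xor_sum_top n a b : (a <= 2 ^ n)%N -> (b <= 2 ^ n)%N ->
  xor_sum (2 ^ n + a) (2 ^ n + b) =
  xor_sum a b + (2 ^ n)%:R ^+ 3 / 2 + 3 * (a%:R + b%:R) * (2 ^ n)%:R ^+ 2 / 2.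
Proof.
move=> an bn; rewrite {1}/xor_sum sum_split -/(xor_sum _ _) xor_sum_topr//.
rewrite (eq_big_nat _ _ (F2 := fun i =>
  (\sum_(0 <= j < 2 ^ n) ((lxor (2 ^ n + i) j)%:R + 2^-1)) +
  (\sum_(0 <= j < b) ((lxor i j)%:R + 2^-1)))); last first.
  move=> i /andP[_ ia]; rewrite sum_split; congr (_ + _).
  apply: eq_big_nat => j /andP[_ jb].
  by rewrite lxor_top ?(leq_trans ia)// ?(leq_trans jb).
rewrite big_split /= xor_sum_block// -/(xor_sum a b) !xor_sum_full// (xor_sumC a) xor_sum_full//.
by field.
Qed.

(* Up to the factor h^3 and an error O(h), the gap of the triple made of fxor at the grid
   point (a h, b h, c h), see gap_grid. *)
Definition xor_defect (a b c : nat) : R :=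
  a%:R * b%:R * c%:R - xor_sum a b - xor_sum a c - xor_sum b c
  + 2^-1 * (xor_sum a a + xor_sum b b + xor_sum c c).

(* Homogenised in N = 2 ^ n.  Passing from the cube of side N to the octant of the cube of
   side 2N whose first corner is raised to N changes xor_defect by - odd_lower; raising all
   three corners changes it by - ones_lower.  Hence nonnegativity alone is not inductive,
   but the lower bounds in defect_bounds are. *)
Definition odd_lower (N x y z : R) : R := - 4^-1 * (N ^+ 3 - 2 * N ^+ 2 * (y + z)
  + 4 * N * y * z + 6 * N ^+ 2 * x - 4 * N * x * y - 4 * N * x * z).

Definition ones_lower (N x y z : R) : R := - 4^-1 * (N ^+ 3 - 2 * N ^+ 2 * (x + y + z)
  + 4 * N * (x * y + x * z + y * z)).

Definition defect_bounds n a b c := let N : R := (2 ^ n)%:R in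
  [/\ 0 <= xor_defect a b c, odd_lower N a%:R b%:R c%:R <= xor_defect a b c,
   odd_lower N b%:R a%:R c%:R <= xor_defect a b c,
   odd_lower N c%:R a%:R b%:R <= xor_defect a b c & ones_lower N a%:R b%:R c%:R <= xor_defect a b c].

End XorSums.

(** * The discrete gap: nonnegative everywhere, zero on xor triples *)

Section XorDefectBounds.

(** A polynomial affine in each variable and nonnegative at the vertices of the cube is a
    nonnegative combination of these products. They are the certificates that [lra] needs in the
    induction step. *)
Lemma corner_products (N x y z : R) : 0 <= x <= N -> 0 <= y <= N -> 0 <= z <= N ->
  [/\ 0 <= x * y * z, 0 <= x * y * (N - z), 0 <= x * (N - y) * z,
      0 <= x * (N - y) * (N - z) &
  [/\ 0 <= (N - x) * y * z, 0 <= (N - x) * y * (N - z),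
      0 <= (N - x) * (N - y) * z & 0 <= (N - x) * (N - y) * (N - z)]].
Proof.
move=> /andP[x0 x1] /andP[y0 y1] /andP[z0 z1].
by split; [..|split]; rewrite !mulr_ge0 ?subr_ge0.
Qed.

Lemma defect_bounds_base a b c : (a <= 1)%N -> (b <= 1)%N -> (c <= 1)%N ->
  defect_bounds 0 a b c.
Proof.
have sum11 : xor_sum 1 1 = 2^-1 by rewrite /xor_sum !big_nat1 add0r.
rewrite /defect_bounds /xor_defect /odd_lower /ones_lower expn0.
case: a => [|[|//]] _; case: b => [|[|//]] _; case: c => [|[|//]] _ /=;
  rewrite ?xor_sum0l ?xor_sum0r ?sum11 ?mulr0n ?mulr1n; split; lra.
Qed.

(** The top bits select one of eight octants. The doubling formulas write the defect there as the
    defect of the remainders plus a polynomial affine in each of them, so the new bounds follow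
    linearly from the five old ones and the corner products. *)
Lemma defect_bounds_step n :
  (forall a b c, (a <= 2 ^ n)%N -> (b <= 2 ^ n)%N -> (c <= 2 ^ n)%N ->
    defect_bounds n a b c) ->
  forall a b c, (a <= 2 ^ n.+1)%N -> (b <= 2 ^ n.+1)%N -> (c <= 2 ^ n.+1)%N ->
    defect_bounds n.+1 a b c.
Proof.
move=> IH.
have split_top d : (d <= 2 ^ n.+1)%N ->
    (d <= 2 ^ n)%N \/ exists2 d', (d' <= 2 ^ n)%N & d = (2 ^ n + d')%N.
  rewrite expnS => dn; case: (leqP d (2 ^ n)) => dn'; [by left|right].
  by exists (d - 2 ^ n)%N; lia.
have le01 d : (d <= 2 ^ n)%N -> (0 : R) <= (d%:R : R) <= (2 ^ n)%:R.
  by move=> dn; rewrite ler0n ler_nat.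
have E2 : (2 ^ n.+1)%:R = 2 * (2 ^ n)%:R :> R by rewrite expnS natrM.
move=> a b c /split_top[an|[a' an ->]] /split_top[bn|[b' bn ->]] /split_top[cn|[c' cn ->]].
(* The induction hypothesis is taken at the remainders [d'] of the raised coordinates and at the
   other coordinates as they are. *)
all: match goal with |- defect_bounds _ ?u ?v ?w =>
  let f d := match d with (_ + ?d')%N => d' | _ => d end in
  let u := f u in let v := f v in let w := f w in
  have [] := IH u v w an bn cn;
  have [] := corner_products _ _ _ _ (le01 u an) (le01 v bn) (le01 w cn) end.
all: rewrite /defect_bounds /xor_defect ?E2 ?xor_sum_top ?xor_sum_topl ?xor_sum_topr//
  ?natrD /odd_lower /ones_lower.
all: move=> ? ? ? ? [? ? ? ?] ? ? ? ? ?.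
all: split; lra.
Qed.

Lemma defect_boundsP n a b c : (a <= 2 ^ n)%N -> (b <= 2 ^ n)%N -> (c <= 2 ^ n)%N ->
  defect_bounds n a b c.
Proof.
elim: n a b c => [|n IH]; first exact: defect_bounds_base.
exact: defect_bounds_step.
Qed.

Lemma xor_defect_ge0 a b c : 0 <= xor_defect a b c.
Proof.
(* The exponent [a + b + c] is a crude choice of a power of two that dominates all three numbers. *)
have lt2 d : (d <= a + b + c -> d <= 2 ^ (a + b + c))%N.
  by move=> /leq_trans; apply; exact/ltnW/ltn_expl.
have an : (a <= 2 ^ (a + b + c))%N by apply: lt2; lia.
have bn : (b <= 2 ^ (a + b + c))%N by apply: lt2; lia.
have cn : (c <= 2 ^ (a + b + c))%N by apply: lt2; lia.
by have [] := defect_boundsP _ _ _ _ an bn cn.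
Qed.

(** Raising exactly two coordinates by [2 ^ n] leaves [xor_defect] unchanged, and the top bits of
    [i], [j], [lxor i j] contain zero or two ones. Stripping bits thus leads down to the zero
    triple. *)
Lemma xor_defect_xor i j : xor_defect i j (lxor i j) = 0.
Proof.
have : (i < 2 ^ (i + j))%N /\ (j < 2 ^ (i + j))%N.
  by split; apply: leq_ltn_trans (ltn_expl _ (ltnSn 1)); rewrite ?leq_addr ?leq_addl.
move: (i + j)%N => m; elim: m i j => [|n IH] i j [].
  by rewrite expn0 !ltnS !leqn0 => /eqP-> /eqP->; rewrite /xor_defect !xor_sum0l; lra.
have split_top d : (d < 2 ^ n.+1)%N ->
    (d < 2 ^ n)%N \/ exists2 d', (d' < 2 ^ n)%N & d = (2 ^ n + d')%N.
  rewrite expnS => dn; case: (ltnP d (2 ^ n)) => dn'; [by left|right].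
  by exists (d - 2 ^ n)%N; lia.
move=> /split_top[i0|[i' i0 ->]] /split_top[j0|[j' j0 ->]].
- exact: IH.
- have <- := IH _ _ (conj i0 j0).
  have := ltnW (lxor_lt n _ _ i0 j0); rewrite lxor_topr//.
  move: (lxor i j') => k kn; have := ltnW i0; have := ltnW j0 => jn in_.
  by rewrite /xor_defect ?xor_sum_top ?xor_sum_topl ?xor_sum_topr// ?natrD; lra.
- have <- := IH _ _ (conj i0 j0).
  have := ltnW (lxor_lt n _ _ i0 j0); rewrite lxor_topl//.
  move: (lxor i' j) => k kn; have := ltnW i0; have := ltnW j0 => jn in_.
  by rewrite /xor_defect ?xor_sum_top ?xor_sum_topl ?xor_sum_topr// ?natrD; lra.
- have <- := IH _ _ (conj i0 j0).
  have := ltnW (lxor_lt n _ _ i0 j0); rewrite lxor_top//.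
  move: (lxor i' j') => k kn; have := ltnW i0; have := ltnW j0 => jn in_.
  by rewrite /xor_defect ?xor_sum_top ?xor_sum_topl ?xor_sum_topr// ?natrD; lra.
Qed.

End XorDefectBounds.

(** * Binary digits of the real xor, its self-similarity and measurability *)

Section XorR.
Implicit Types x y s t : R.

Definition xdigit x y (n : nat) : R := (bdigit x n (+) bdigit y n)%:R / 2 ^+ n.+1.

Lemma pow2_gt0 n : 0 < (2 : R) ^+ n. Proof. exact: exprn_gt0. Qed.

Lemma xdigit_ge0 x y n : 0 <= xdigit x y n.
Proof. by rewrite divr_ge0// ltW// pow2_gt0. Qed.

Lemma xdigit_le x y n : xdigit x y n <= (2 ^+ n.+1)^-1.
Proof.
rewrite ler_piMl ?invr_ge0 ?(ltW (pow2_gt0 _))//.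
by case: (_ (+) _); rewrite ?ler01.
Qed.

Lemma series_xdigit_le x y n : series (xdigit x y) n <= 1 - (2 ^+ n)^-1.
Proof.
elim: n => [|n IH]; first by rewrite /series/= big_geq// expr0 invr1 subrr.
rewrite seriesSr; have := xdigit_le x y n.
have : (2 ^+ n)^-1 = 2 * (2 ^+ n.+1)^-1 :> R.
  by rewrite exprS invfM mulrA divff ?mul1r.
lra.
Qed.

Lemma xorR_cvg x y : series (xdigit x y) @ \oo --> xorR x y.
Proof.
apply: nondecreasing_is_cvgn.
  by apply: nondecreasing_series => n _ _; exact: xdigit_ge0.
exists 1 => _ [n _ <-]; apply: le_trans (series_xdigit_le x y n) _.
by rewrite gerBl invr_ge0 ltW// pow2_gt0.
Qed.

Lemma xorR_ge0 x y : 0 <= xorR x y.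
Proof.
apply: limr_ge; first by apply/cvg_ex; eexists; exact: xorR_cvg.
by apply: nearW => n; apply: sumr_ge0 => i _; exact: xdigit_ge0.
Qed.

Lemma xorR_le1 x y : xorR x y <= 1.
Proof.
apply: limr_le; first by apply/cvg_ex; eexists; exact: xorR_cvg.
apply: nearW => n; apply: le_trans (series_xdigit_le x y n) _.
by rewrite gerBl invr_ge0 ltW// pow2_gt0.
Qed.

Lemma bdigit_half0 (e : bool) x : 0 <= x < 1 -> bdigit ((e%:R + x) / 2) 0 = e.
Proof.
move=> /andP[x0 x1]; rewrite /bdigit ifF; last first.
  by apply/eqP => h; case: e h => /=; lra.
rewrite expr1 mulrCA divff// mulr1 (@truncn_def _ _ e) ?oddb//.
by case: e => /=; lra.
Qed.

(** Halving shifts the expansion by one place. The bound [x < 1] keeps both numbers away from 1 and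
    its exceptional expansion. *)
Lemma bdigit_halfS (e : bool) x n : 0 <= x < 1 ->
  bdigit ((e%:R + x) / 2) n.+1 = bdigit x n.
Proof.
move=> /andP[x0 x1]; rewrite /bdigit ifF; last first.
  by apply/eqP => h; case: e h => /=; lra.
rewrite ifF; last by apply/eqP => h; lra.
have p0 := ltW (pow2_gt0 n.+1).
have /truncn_itv tx : 0 <= 2 ^+ n.+1 * x by rewrite mulr_ge0.
(* The integer part gains [e * 2 ^ n.+1], an even number, so its parity is the digit of [x]. *)
rewrite (@truncn_def _ _ (e * 2 ^ n.+1 + Num.truncn (2 ^+ n.+1 * x))%N).
  by rewrite oddD oddM expnS oddM/= andbF.
rewrite -addnS !natrD natrM natrX.
rewrite [2 ^+ n.+2](exprS 2 n.+1) (mulrC 2) -mulrA (mulrC 2) divfK//.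
by rewrite mulrDr (mulrC e%:R) lerD2l ltrD2l.
Qed.

Lemma xorR_half (e f : bool) x y : 0 <= x < 1 -> 0 <= y < 1 ->
  xorR ((e%:R + x) / 2) ((f%:R + y) / 2) = ((e (+) f)%:R + xorR x y) / 2.
Proof.
move=> x01 y01; apply: cvg_lim => //.
rewrite -cvg_shiftS.
rewrite [X in X x @[x --> _]](_ : _ =
    fun n => ((e (+) f)%:R + series (xdigit x y) n) / 2).
  by apply: cvgM; [apply: cvgD; [exact: cvg_cst|exact: xorR_cvg]|exact: cvg_cst].
apply/funext => n /=; rewrite /series/= big_nat_recl//.
rewrite [RHS]mulrDl !bdigit_half0// expr1; congr (_ + _).
rewrite big_distrl/=; apply: eq_bigr => i _.
by rewrite !bdigit_halfS// /xdigit [2 ^+ i.+2]exprS invfM mulrA mulrAC.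
Qed.

(** Leading digits are peeled off one by one through [xorR_half]. The upper bound is not strict
    because complementary digit tails have xor 1. *)
Lemma xorR_cell n i j x y : (i < 2 ^ n)%N -> (j < 2 ^ n)%N ->
  i%:R / 2 ^+ n <= x < i.+1%:R / 2 ^+ n -> j%:R / 2 ^+ n <= y < j.+1%:R / 2 ^+ n ->
  (lxor i j)%:R / 2 ^+ n <= xorR x y <= (lxor i j).+1%:R / 2 ^+ n.
Proof.
elim: n i j x y => [|n IH] i j x y.
  rewrite expn0 !ltnS !leqn0 => /eqP-> /eqP-> _ _.
  by rewrite expr0 !divr1 xorR_ge0 xorR_le1.
have split_top d : (d < 2 ^ n.+1)%N ->
    exists (e : bool) d', (d' < 2 ^ n)%N /\ d = (e * 2 ^ n + d')%N.
  rewrite expnS => dn; case: (ltnP d (2 ^ n)) => dn'; [exists false, d|]; last first.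
    exists true, (d - 2 ^ n)%N; lia.
  lia.
move=> /split_top[e [i' [i0 ->]]] /split_top[f [j' [j0 ->]]] xi yj.
have halfE (p v u : R) : 0 < p -> (v * p + u) * (2^-1 / p) = (v + u / p) / 2.
  by move=> p0; field; rewrite gt_eqF.
have half (g : bool) d (z : R) : (d < 2 ^ n)%N ->
    (g * 2 ^ n + d)%:R / 2 ^+ n.+1 <= z < (g * 2 ^ n + d).+1%:R / 2 ^+ n.+1 ->
    exists2 z', d%:R / 2 ^+ n <= z' < d.+1%:R / 2 ^+ n & z = (g%:R + z') / 2.
  move=> dn zd; exists (2 * z - g%:R); last by field.
  have := pow2_gt0 n; move: zd; rewrite -addnS !natrD natrM natrX exprS invfM.
  set p := 2 ^+ n => zd p0; move: zd.
  rewrite !halfE//; move: (_ / p) (_ / p) => u v; lra.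
have unit d (z : R) : (d < 2 ^ n)%N -> d%:R / 2 ^+ n <= z < d.+1%:R / 2 ^+ n -> 0 <= z < 1.
  move=> dn /andP[z0 z1]; rewrite (le_trans _ z0) ?divr_ge0 ?(ltW (pow2_gt0 _))//=.
  apply: lt_le_trans z1 _; rewrite ler_pdivrMr ?pow2_gt0// mul1r -natrX ler_nat.
  exact: dn.
have [x' xi' ->] := half _ _ _ i0 xi; have [y' yj' ->] := half _ _ _ j0 yj.
rewrite xorR_half ?(unit _ _ i0 xi') ?(unit _ _ j0 yj')//.
have /andP[] := IH _ _ _ _ i0 j0 xi' yj'.
rewrite lxor_split//.
have -> : lxor e f = (e (+) f) :> nat by case: (e); case: (f).
have := pow2_gt0 n; rewrite -addnS !natrD natrM natrX exprS invfM.
set p := 2 ^+ n => p0; rewrite !halfE//.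
move: (_ / p) (_ / p) => u v; lra.
Qed.

Lemma measurable_bdigit n : measurable_fun setT (fun x : R => bdigit x n).
Proof.
apply: measurable_fun_ifT => //.
  exact: measurable_fun_eqr.
apply: (measurable_fun_bool true); rewrite setTI.
rewrite (_ : _ @^-1` _ = \bigcup_(k in [set k | odd k])
    [set` `[(k%:R / 2 ^+ n.+1 : R), k.+1%:R / 2 ^+ n.+1[ ]).
  by apply: bigcup_measurable => k _; exact: measurable_itv.
have c0 := pow2_gt0 n.+1.
apply/seteqP; split => [x /= ox|x [k /= ok]].
  exists (Num.truncn (2 ^+ n.+1 * x)) => //=.
  (* [Num.truncn] is 0 on negative reals, so an odd value forces nonnegativity. *)
  have x0 : 0 <= 2 ^+ n.+1 * x.
    by move: ox; rewrite truncn_floor; case: ifP.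
  rewrite in_itv/= ler_pdivrMr// ltr_pdivlMr// (mulrC x); exact: truncn_itv.
rewrite in_itv/= ler_pdivrMr// ltr_pdivlMr// (mulrC x) => xk.
by rewrite (truncn_def xk).
Qed.

Lemma measurable_xorR : measurable_fun setT (fun p : R * R => xorR p.1 p.2).
Proof.
apply: (@measurable_fun_cvg _ _ _ _ (fun n p => series (xdigit p.1 p.2) n)).
  move=> m; apply: measurable_sum => i.
  apply: measurable_funM; last exact: measurable_cst.
  rewrite [X in measurable_fun _ X](_ : _ = fun p : R * R =>
    if bdigit p.1 i then (if bdigit p.2 i then 0 else 1)
    else (if bdigit p.2 i then 1 else 0)); last first.
    by apply/funext => p; case: bdigit; case: bdigit.
  have m1 : measurable_fun setT (fun p : R * R => bdigit p.1 i).
    by apply: (measurableT_comp (measurable_bdigit i)); exact: measurable_fst.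
  have m2 : measurable_fun setT (fun p : R * R => bdigit p.2 i).
    by apply: (measurableT_comp (measurable_bdigit i)); exact: measurable_snd.
  by do !apply: measurable_fun_ifT => //.
by move=> p _; exact: xorR_cvg.
Qed.

End XorR.

(** * Integrals of xor over rectangles and mixed differences of [Ixor] *)

Section IxorRect.
Local Notation mu := (@lebesgue_measure R).
Implicit Types (A B : set R) (x y z w s t u v m M : R).

Definition Irect A B : \bar R :=
  (\int[mu]_(t in A) \int[mu]_(s in B) (xorR s t)%:E)%E.

Lemma measurable_xorR_s t B : measurable_fun B (fun s : R => (xorR s t)%:E).
Proof.
apply/measurable_EFinP; apply: (@measurable_funS _ _ _ _ setT) => //.
apply: (measurableT_comp measurable_xorR (f := fun q => xorR q.1 q.2) (g := fun s => (s, t))).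
exact: measurable_pair2.
Qed.

Lemma measurable_Irect_inner A B : measurable B ->
  measurable_fun A (fun t : R => \int[mu]_(s in B) (xorR s t)%:E)%E.
Proof.
move=> mB; apply: (@measurable_funS _ _ _ _ setT) => //.
(* Extension by zero outside [B] turns the inner integral into a section integral over the whole
   line, to which Tonelli measurability applies. *)
pose f (p : R * R) := ((fun q : R * R => (xorR q.2 q.1)%:E) \_ (setT `*` B)) p.
have mf : measurable_fun setT f.
  apply/(measurable_restrictT _ _).1; first exact: measurableX.
  apply: (@measurable_funS _ _ _ _ setT) => //.
  apply/measurable_EFinP.
  apply: (measurableT_comp measurable_xorR (f := fun q => xorR q.1 q.2)
    (g := fun q : R * R => (q.2, q.1))).
  exact: measurable_swap.
have f0 p : (0 <= f p)%E.
  by rewrite /f patchE; case: ifP => //; rewrite lee_fin xorR_ge0.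
have := measurable_fun_fubini_tonelli_F (m2 := mu) f mf f0.
congr measurable_fun; apply/funext => t; rewrite /fubini_F [RHS]integral_mkcond.
apply: eq_integral => s _; rewrite /f !patchE.
by rewrite in_setX in_setT.
Qed.

Lemma inner_ge0 B t : (0 <= \int[mu]_(s in B) (xorR s t)%:E)%E.
Proof. by apply: integral_ge0 => s _; rewrite lee_fin xorR_ge0. Qed.

Lemma IrectUl A A' B : measurable A -> measurable A' -> measurable B ->
  [disjoint A & A'] -> Irect (A `|` A') B = (Irect A B + Irect A' B)%E.
Proof.
move=> mA mA' mB AA'; rewrite /Irect ge0_integral_setU//.
  exact: measurable_Irect_inner.
by move=> t _; exact: inner_ge0.
Qed.

Lemma IrectUr A B B' : measurable A -> measurable B -> measurable B' ->
  [disjoint B & B'] -> Irect A (B `|` B') = (Irect A B + Irect A B')%E.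
Proof.
move=> mA mB mB' BB'; rewrite /Irect -ge0_integralD//.
- apply: eq_integral => t _; rewrite ge0_integral_setU//.
    exact: measurable_xorR_s.
  by move=> s _; rewrite lee_fin xorR_ge0.
- by move=> t _; exact: inner_ge0.
- exact: measurable_Irect_inner.
- by move=> t _; exact: inner_ge0.
- exact: measurable_Irect_inner.
Qed.

Lemma Irect_bounds A B (m M a b : R) : measurable A -> measurable B ->
  0 <= m -> mu A = a%:E -> mu B = b%:E ->
  (forall s t, B s -> A t -> m <= xorR s t <= M) ->
  ((m * (a * b))%:E <= Irect A B <= (M * (a * b))%:E)%E.
Proof.
move=> mA mB m0 Aa Bb mM.
have inner t : A t -> ((m * b)%:E <= \int[mu]_(s in B) (xorR s t)%:E <= (M * b)%:E)%E.
  move=> At; rewrite 2!EFinM -Bb -!integral_cst//; apply/andP; split.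
    apply: ge0_le_integral => //.
    - exact: measurable_xorR_s.
    - by move=> s Bs; rewrite lee_fin; have /andP[] := mM s t Bs At.
  apply: ge0_le_integral => //.
  - by move=> s Bs; rewrite lee_fin xorR_ge0.
  - exact: measurable_xorR_s.
  - by move=> s Bs; rewrite lee_fin; have /andP[] := mM s t Bs At.
have b0 : 0 <= b by rewrite -lee_fin -Bb.
rewrite (mulrC a) 2!mulrA (EFinM (m * b)) (EFinM (M * b)) -Aa -!integral_cst//; apply/andP; split.
  apply: ge0_le_integral => //.
  - by move=> t At; rewrite lee_fin mulr_ge0.
  - exact: measurable_Irect_inner.
  - by move=> t /inner/andP[].
apply: ge0_le_integral => //.
- by move=> t At; exact: inner_ge0.
- exact: measurable_Irect_inner.
- by move=> t /inner/andP[].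
Qed.

(** Half-open intervals tile without overlap, which makes [Irect] exactly additive. *)
Definition co (x y : R) : set R := [set` `[x, y[].

Lemma mu_co x y : x <= y -> mu (co x y) = (y - x)%:E.
Proof.
move=> xy; rewrite lebesgue_measure_itv/= lte_fin; case: ifPn => // h.
by have -> : y = x by [lra]; rewrite subrr.
Qed.

Lemma measurable_co x y : measurable (co x y).
Proof. exact: measurable_itv. Qed.
Hint Resolve measurable_co : core.

Lemma co_split x y z : x <= y -> y <= z -> co x z = co x y `|` co y z.
Proof.
move=> xy yz; apply/seteqP; split => t; rewrite /co/= !in_itv/=.
  by case: (ltP t y) => ty; [left|right]; lra.
by case; lra.
Qed.

Lemma co_disj x y z w : y <= z -> [disjoint co x y & co z w].
Proof.
move=> yz; apply/disj_setPS => t [] /=; rewrite /co/= !in_itv/=; lra.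
Qed.

Lemma Ixor_rect x y : Ixor x y = fine (Irect (co 0 x) (co 0 y)).
Proof.
rewrite /Ixor /Irect /co integral_itv_bndo_bndc; last exact: measurable_Irect_inner.
apply: (congr1 fine); apply: eq_integral => t _; symmetry.
apply: integral_itv_bndo_bndc.
exact: measurable_xorR_s.
Qed.

Lemma Irect_co_fin a b c d : a <= b -> c <= d -> Irect (co a b) (co c d) \is a fin_num.
Proof.
move=> ab cd.
have /andP[h1 h2] : ((0 * ((b - a) * (d - c)))%:E <= Irect (co a b) (co c d)
    <= (1 * ((b - a) * (d - c)))%:E)%E.
  apply: Irect_bounds => //; [exact: mu_co|exact: mu_co|].
  by move=> s t _ _; rewrite xorR_ge0 xorR_le1.
rewrite fin_numE -ltey -ltNye.
by rewrite (lt_le_trans _ h1) ?ltNyr// (le_lt_trans h2) ?ltry.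
Qed.

Definition mdiff (f : R -> R -> R) x x' y y' := f x' y' - f x' y - f x y' + f x y.

(** The rectangle from the origin splits into four, and in the mixed difference all but the upper
    right part cancel. *)
Lemma mdiff_Ixor x x' y y' : 0 <= x <= x' -> 0 <= y <= y' ->
  mdiff (@Ixor R) x x' y y' = fine (Irect (co x x') (co y y')).
Proof.
move=> /andP[x0 xx] /andP[y0 yy]; have x'0 := le_trans x0 xx; have y'0 := le_trans y0 yy.
rewrite /mdiff !Ixor_rect (co_split _ _ _ x0 xx) (co_split _ _ _ y0 yy).
rewrite !IrectUl ?co_disj//; last exact: measurableU.
rewrite !IrectUr ?co_disj//.
(* Finiteness of the four parts lets [fine] commute with their sums. *)
have := Irect_co_fin _ _ _ _ x0 y0; have := Irect_co_fin _ _ _ _ x0 yy.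
have := Irect_co_fin _ _ _ _ xx y0; have := Irect_co_fin _ _ _ _ xx yy.
move: (Irect _ _) (Irect _ _) (Irect _ _) (Irect _ _).
by move=> [a| |] [b| |] [c| |] [d| |]//= _ _ _ _; ring.
Qed.

Lemma Ixor_bounds x x' y y' m M : 0 <= x <= x' -> 0 <= y <= y' -> 0 <= m ->
  (forall s t, y <= s < y' -> x <= t < x' -> m <= xorR s t <= M) ->
  m * ((x' - x) * (y' - y)) <= mdiff (@Ixor R) x x' y y' <= M * ((x' - x) * (y' - y)).
Proof.
move=> x01 y01 m0 mM; rewrite mdiff_Ixor//.
have /andP[_ xx] := x01; have /andP[_ yy] := y01.
rewrite -!lee_fin fineK ?Irect_co_fin//.
by apply: Irect_bounds => //; exact: mu_co.
Qed.

Lemma Ixor0l y : Ixor 0 y = 0 :> R.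
Proof.
by rewrite Ixor_rect /Irect /co set_itv_ge ?integral_set0// bnd_simp ltxx.
Qed.

Lemma Ixor0r x : 0 <= x -> Ixor x 0 = 0 :> R.
Proof.
move=> x0; rewrite Ixor_rect /Irect [co 0 0]set_itv_ge ?bnd_simp ?ltxx//.
by under eq_integral do rewrite integral_set0; rewrite integral0.
Qed.

Lemma Ixor_cell n i j (h := (2 ^+ n)^-1 : R) : (i < 2 ^ n)%N -> (j < 2 ^ n)%N ->
  (lxor i j)%:R * h ^+ 3 <= mdiff (@Ixor R) (i%:R * h) (i.+1%:R * h) (j%:R * h) (j.+1%:R * h)
    <= (lxor i j).+1%:R * h ^+ 3.
Proof.
move=> ni nj; have h0 : 0 < h by rewrite invr_gt0 pow2_gt0.
have E (k : nat) : k%:R * h ^+ 3 =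
    (k%:R * h) * ((i.+1%:R * h - i%:R * h) * (j.+1%:R * h - j%:R * h)).
  by rewrite -!natr1; ring.
rewrite !E; apply: Ixor_bounds.
- by rewrite mulr_ge0 ?(ltW h0)//= ler_pM2r// ler_nat.
- by rewrite mulr_ge0 ?(ltW h0)//= ler_pM2r// ler_nat.
- by rewrite mulr_ge0 ?(ltW h0).
- by move=> s t sj ti; rewrite Nat.lxor_comm; exact: xorR_cell.
Qed.

(** Since [J] vanishes on the axes, an increment in one variable is a mixed difference over a
    rectangle resting on an axis. Its area is at most the increment, as the other side is at most
    1. *)
Lemma dist_of_mdiff_bounds (J : R -> R -> R) :
  (forall y, J 0 y = 0) -> (forall x, 0 <= x -> J x 0 = 0) ->
  (forall x x' y y', 0 <= x <= x' -> 0 <= y <= y' ->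
    0 <= mdiff J x x' y y' <= (x' - x) * (y' - y)) ->
  forall x x' y y', 0 <= x <= 1 -> 0 <= x' <= 1 -> 0 <= y <= 1 -> 0 <= y' <= 1 ->
  `|J x' y' - J x y| <= `|x' - x| + `|y' - y|.
Proof.
move=> J0l J0r Jb.
have half u v w : 0 <= u <= v -> v <= 1 -> 0 <= w <= 1 ->
    `|J v w - J u w| <= v - u /\ `|J w v - J w u| <= v - u.
  move=> uv v1 w01.
  have u0 : 0 <= u by lra.
  have v0 : 0 <= v by lra.
  have w0 : (0 : R) <= (0 : R) <= w by rewrite lexx; case/andP: w01.
  have uvw : (v - u) * w <= v - u by rewrite ler_piMr//; lra.
  have := Jb _ _ _ _ uv w0; have := Jb _ _ _ _ w0 uv.
  by rewrite /mdiff !J0l (J0r _ u0) (J0r _ v0) !ler_norml; split; lra.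
move=> x x' y y' x01 x'01 y01 y'01.
have -> : J x' y' - J x y = (J x' y' - J x y') + (J x y' - J x y) by ring.
apply: le_trans (ler_normD _ _) _; apply: lerD.
  case: (leP x x') => xx.
    by rewrite [leRHS]ger0_norm ?subr_ge0//; apply: (half x x' y' _ _ _).1; lra.
  rewrite distrC [leRHS]distrC [leRHS]ger0_norm ?subr_ge0 ?(ltW xx)//.
  by apply: (half x' x y' _ _ _).1; lra.
case: (leP y y') => yy.
  by rewrite [leRHS]ger0_norm ?subr_ge0//; apply: (half y y' x _ _ _).2; lra.
rewrite distrC [leRHS]distrC [leRHS]ger0_norm ?subr_ge0 ?(ltW yy)//.
by apply: (half y' y x _ _ _).2; lra.
Qed.

Lemma Ixor_dist x x' y y' : 0 <= x <= 1 -> 0 <= x' <= 1 -> 0 <= y <= 1 -> 0 <= y' <= 1 ->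
  `|Ixor x' y' - Ixor x y| <= `|x' - x| + `|y' - y|.
Proof.
apply: dist_of_mdiff_bounds; [exact: Ixor0l|exact: Ixor0r|].
move=> u u' v v' uu vv.
have := @Ixor_bounds u u' v v' 0 1 uu vv (lexx 0).
rewrite mul0r mul1r; apply => s t _ _.
by rewrite xorR_ge0 xorR_le1.
Qed.

End IxorRect.

(** * Uniform continuity on the unit square *)

Section UnifCont.
Implicit Types (G : R -> R -> R) (x y d e : R).

Definition ucont2 G := forall e, 0 < e -> exists2 d, 0 < d &
  forall x y x' y', 0 <= x <= 1 -> 0 <= y <= 1 -> 0 <= x' <= 1 -> 0 <= y' <= 1 ->
  `|x - x'| <= d -> `|y - y'| <= d -> `|G x y - G x' y'| <= e.

Lemma ucont2_of_continuous G :
  {within unit_sq R, continuous (fun p => G p.1 p.2)} -> ucont2 G.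
Proof.
move=> /subspace_continuousP cG e e0.
have : compact (unit_sq R) by apply: compact_setX; exact: segment_compact.
(* The modulus [d] is the filter parameter, tending to 0 from the right; compactness then yields one
   [d] for all points. *)
move=> /compact_near_coveringP /(_ R 0^'+ (fun d p => unit_sq R p -> forall q,
  unit_sq R q -> `|p.1 - q.1| <= d -> `|p.2 - q.2| <= d ->
  `|G p.1 p.2 - G q.1 q.2| <= e) _).
case.
  move=> p sp; have e20 : 0 < e / 2 by rewrite divr_gt0.
  have /cvgrPdist_le/(_ _ e20) := cG p sp.
  rewrite /within/= => /nbhs_ballP[r /= r0 rG].
  have r20 : 0 < r / 2 by rewrite divr_gt0.
  (* Half radii keep both [q] and [q'] in the ball of radius [r] about [p], on which [G] varies by
     at most [e / 2] from its value at [p]. *)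
  exists (ball p (r / 2), [set d | d < r / 2]).
    split; first exact: nbhsx_ballx.
    exact: nbhs_right_lt.
  move=> [q d] /= [[q1 q2] dr] sq q' sq' d1 d2.
  have h1 : `|G p.1 p.2 - G q.1 q.2| <= e / 2.
    apply: rG => //; split.
      by apply: le_ball q1; lra.
    by apply: le_ball q2; lra.
  have h2 : `|G p.1 p.2 - G q'.1 q'.2| <= e / 2.
    apply: rG => //; move: q1 q2; rewrite /ball/= => q1 q2; split.
      rewrite /ball/= (_ : p.1 - q'.1 = (p.1 - q.1) + (q.1 - q'.1)); last by ring.
      by apply: le_lt_trans (ler_normD _ _) _; lra.
    rewrite /ball/= (_ : p.2 - q'.2 = (p.2 - q.2) + (q.2 - q'.2)); last by ring.
    by apply: le_lt_trans (ler_normD _ _) _; lra.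
  rewrite (_ : _ - _ = (G p.1 p.2 - G q'.1 q'.2) - (G p.1 p.2 - G q.1 q.2)); last by ring.
  by apply: le_trans (ler_normB _ _) _; lra.
move=> d /= d0 dP; exists (d / 2); first by rewrite divr_gt0.
move=> x y x' y' x01 y01 x'01 y'01 dx dy.
apply: (dP (d / 2) _ _ (x, y) _ _ (x', y')) => //.
- by rewrite /= sub0r normrN gtr0_norm; lra.
- by rewrite divr_gt0.
Qed.

Lemma within_continuous_of_ucont (f : R -> R) :
  (forall e, 0 < e -> exists2 d, 0 < d & forall x y, 0 <= x <= 1 -> 0 <= y <= 1 ->
    `|x - y| <= d -> `|f x - f y| <= e) ->
  {within `[0, 1], continuous f}.
Proof.
move=> uf; apply/subspace_continuousP => x; rewrite /= in_itv/= => x01.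
apply/cvgrPdist_le => e /uf[d d0 fd].
rewrite /within/=; apply/nbhs_ballP; exists d => //= y.
rewrite /ball/= in_itv/= => xy y01; apply: fd => //; exact: ltW.
Qed.

Lemma ucont2_lipschitz G : (forall x y x' y', 0 <= x <= 1 -> 0 <= y <= 1 ->
    0 <= x' <= 1 -> 0 <= y' <= 1 -> `|G x y - G x' y'| <= 2 * (`|x - x'| + `|y - y'|)) ->
  ucont2 G.
Proof.
move=> LG e e0; exists (e / 4); first by rewrite divr_gt0.
by move=> x y x' y' x01 y01 x'01 y'01 a b; apply: le_trans (LG _ _ _ _ _ _ _ _) _ => //; lra.
Qed.

(** In each variable the Lipschitz constant is 1 from [J x y] plus 1/2 from the diagonal term, below
    the 2 of [ucont2_lipschitz]. *)
Lemma ucont2_diag_corrected (J : R -> R -> R) :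
  (forall x x' y y', 0 <= x <= 1 -> 0 <= x' <= 1 -> 0 <= y <= 1 -> 0 <= y' <= 1 ->
     `|J x' y' - J x y| <= `|x' - x| + `|y' - y|) ->
  ucont2 (fun x y => J x y - 4^-1 * J x x - 4^-1 * J y y).
Proof.
move=> dJ; apply: ucont2_lipschitz => x y x' y' x01 y01 x'01 y'01.
have a := dJ _ _ _ _ x'01 x01 y'01 y01.
have b := dJ _ _ _ _ x'01 x01 x'01 x01.
have c := dJ _ _ _ _ y'01 y01 y'01 y01.
rewrite (_ : _ - _ = (J x y - J x' y') -
  (4^-1 * (J x x - J x' x') + 4^-1 * (J y y - J y' y'))); last by ring.
apply: le_trans (ler_normB _ _) _.
have := ler_normD (4^-1 * (J x x - J x' x')) (4^-1 * (J y y - J y' y')).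
rewrite !normrM (@ger0_norm _ 4^-1) ?invr_ge0//.
have := normr_ge0 (x - x'); have := normr_ge0 (y - y'); lra.
Qed.

End UnifCont.

(** * Dyadic Riemann sums and integrals over the square *)

Section Riemann.
Local Notation mu := (@lebesgue_measure R).
Local Notation mu2 := (mu \x mu)%E.
Local Notation sq := (unit_sq R).
Implicit Types (G : R -> R -> R) (n i j : nat) (x y e d : R).

Definition riemann n G : R :=
  (\sum_(0 <= i < 2 ^ n) \sum_(0 <= j < 2 ^ n) G (i%:R / 2 ^+ n) (j%:R / 2 ^+ n))
  / (2 ^+ n) ^+ 2.

(** The last cell alone is closed on the right, so that the cells partition the closed unit
    interval. *)
Definition cell n i : set R :=
  [set` Interval (BLeft (i%:R / 2 ^+ n : R)) (BSide (i.+1 != 2 ^ n)%N (i.+1%:R / 2 ^+ n : R))].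

Lemma measurable_cell n i : measurable (cell n i).
Proof. exact: measurable_itv. Qed.

Lemma mu_cell n i : mu (cell n i) = ((2 ^+ n)^-1)%:E.
Proof.
have p0 := pow2_gt0 n.
rewrite lebesgue_measure_itv /= lte_fin ltr_pM2r ?invr_gt0// ltr_nat leqnn.
by rewrite -EFinB -mulrBl -natrB// subSnn mul1r.
Qed.

Lemma cell_bounds n i x : (i < 2 ^ n)%N -> cell n i x ->
  [/\ 0 <= x <= 1 & `|x - i%:R / 2 ^+ n| <= (2 ^+ n)^-1].
Proof.
move=> ni; have p0 := pow2_gt0 n; rewrite /cell/= in_itv/= => /andP[x1 x2].
have {}x2 : x <= i.+1%:R / 2 ^+ n by move: x2; case: (_ != _) => // /ltW.
have i0 : 0 <= i%:R / 2 ^+ n :> R by rewrite divr_ge0// ltW.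
have i1 : i.+1%:R / 2 ^+ n <= 1 :> R.
  by rewrite ler_pdivrMr// mul1r -natrX ler_nat.
split; first by apply/andP; split; lra.
by rewrite ger0_norm ?subr_ge0//; move: x2; rewrite -natr1 mulrDl mul1r; lra.
Qed.

Lemma cell_ex n x : 0 <= x <= 1 -> exists2 i, (i < 2 ^ n)%N &
  forall k, (k < 2 ^ n)%N -> (x \in cell n k) = (k == i).
Proof.
move=> /andP[x0 x1]; have p0 := pow2_gt0 n.
have E k : (k < 2 ^ n)%N -> x < 1 -> (x \in cell n k) = (Num.truncn (x * 2 ^+ n) == k).
  move=> kn xlt; rewrite truncn_eq ?mulr_ge0 ?(ltW p0)//.
  rewrite /cell mem_setE in_itv/= ler_pdivrMr//; congr (_ && _).
  case: eqP => [kE|_] /=; last by rewrite ltr_pdivlMr.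
  by rewrite kE natrX divff ?gt_eqF// x1 -[X in _ < X]mul1r ltr_pM2r// xlt.
move: x1; rewrite le_eqVlt => /orP[/eqP x1|xlt]; last first.
  exists (Num.truncn (x * 2 ^+ n)); last by move=> k kn; rewrite E// eq_sym.
  rewrite truncn_lt_nat ?mulr_ge0 ?(ltW p0)// natrX.
  by rewrite -[X in _ < X]mul1r ltr_pM2r.
exists (2 ^ n).-1; first by rewrite prednK ?expn_gt0.
move=> k kn; rewrite x1 /cell mem_setE in_itv/= ler_pdivrMr// mul1r.
rewrite -natrX ler_nat (ltnW kn)/=.
have -> : (k == (2 ^ n).-1) = (k.+1 == 2 ^ n)%N.
  by rewrite -(prednK (expn_gt0 2 n : 0 < _)%N) eqSS.
case: eqP => [->|kN] /=; first by rewrite divff ?lexx// pnatr_eq0 -lt0n expn_gt0.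
rewrite ltr_pdivlMr ?ltr0n ?expn_gt0// mul1r ltr_nat ltnNge kn//.
Qed.

Lemma grid01 n k : (k <= 2 ^ n)%N -> (0 : R) <= (k%:R / 2 ^+ n : R) <= 1.
Proof.
move=> kn; rewrite divr_ge0 ?(ltW (pow2_gt0 _ _))//= ler_pdivrMr ?pow2_gt0//.
by rewrite mul1r -natrX ler_nat.
Qed.

(** The link between integrals and sums: its integral is exactly [riemann n G], while it is
    uniformly close to a uniformly continuous [G]. *)
Definition step n G (p : R * R) : R :=
  \sum_(0 <= i < 2 ^ n) \sum_(0 <= j < 2 ^ n)
    G (i%:R / 2 ^+ n) (j%:R / 2 ^+ n) * \1_(cell n i `*` cell n j) p.

Lemma step_close n G e d : (2 ^+ n)^-1 <= d ->
  (forall x y x' y', 0 <= x <= 1 -> 0 <= y <= 1 -> 0 <= x' <= 1 -> 0 <= y' <= 1 ->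
  `|x - x'| <= d -> `|y - y'| <= d -> `|G x y - G x' y'| <= e) ->
  forall p, sq p -> `|G p.1 p.2 - step n G p| <= e.
Proof.
move=> nd dG [x y] [/= x01 y01]; move: x01 y01; rewrite !in_itv/= => x01 y01.
have [i ni iP] := cell_ex n _ x01; have [j nj jP] := cell_ex n _ y01.
have -> : step n G (x, y) = G (i%:R / 2 ^+ n) (j%:R / 2 ^+ n).
  have sum_single (F : nat -> R) m k : (k < m)%N ->
      (forall l, (l < m)%N -> l != k -> F l = 0) -> \sum_(0 <= l < m) F l = F k.
    move=> km F0; rewrite big_mkord (bigD1 (Ordinal km))//= big1 ?addr0// => l lk.
    by apply: F0 => //; exact: lk.
  rewrite /step (sum_single _ _ i)//; last first.
    move=> l ln li; rewrite big_nat_cond big1// => k /andP[/andP[_ kn] _].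
    rewrite indicE in_setX/= iP// (negbTE li)/= mulr0//.
  rewrite (sum_single _ _ j)//; last first.
    by move=> l ln li; rewrite indicE in_setX/= iP// eqxx jP// (negbTE li) mulr0.
  by rewrite indicE in_setX/= iP// jP// !eqxx mulr1.
have /set_mem/(cell_bounds _ _ _ ni)[_ xi] : x \in cell n i by rewrite iP.
have /set_mem/(cell_bounds _ _ _ nj)[_ yj] : y \in cell n j by rewrite jP.
by apply: dG; rewrite ?grid01 ?(ltnW ni) ?(ltnW nj)//; apply: le_trans nd.
Qed.

Lemma measurable_step n G D : measurable_fun D (step n G).
Proof.
apply: measurable_sum => i; apply: measurable_sum => j.
apply: measurable_funM; first exact: measurable_cst.
by apply: measurable_indic; apply: measurableX; exact: measurable_cell.
Qed.

Lemma measurable_sq : measurable sq.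
Proof. by apply: measurableX; exact: measurable_itv. Qed.

Lemma mu2_sq : mu2 sq = 1%:E.
Proof.
have m1 : mu `[0, 1] = 1%:E by rewrite lebesgue_measure_itv/= lte_fin ltr01 oppr0 adde0.
have -> : mu2 sq = (mu `[0%R, 1%R] * mu `[0%R, 1%R])%E.
  by apply: product_measure1E; exact: measurable_itv.
by rewrite m1 mule1.
Qed.

Lemma bounded_integrable_sq (f : R * R -> R) M : measurable_fun sq f ->
  (forall p, sq p -> `|f p| <= M) -> mu2.-integrable sq (EFin \o f).
Proof.
move=> mf fM; apply: measurable_bounded_integrable => //.
- exact: measurable_sq.
- exact: (eq_ind_r (fun z => (z < +oo)%E) (ltry 1) mu2_sq).
- exists M; split; first exact: num_real.
  by move=> M' MM' p sp; apply: le_trans (ltW MM'); exact: fM.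
Qed.

Lemma step_bounded n G p :
  `|step n G p| <= \sum_(0 <= i < 2 ^ n) \sum_(0 <= j < 2 ^ n) `|G (i%:R / 2 ^+ n) (j%:R / 2 ^+ n)|.
Proof.
apply: le_trans (ler_norm_sum _ _ _) _; apply: ler_sum => i _.
apply: le_trans (ler_norm_sum _ _ _) _; apply: ler_sum => j _.
rewrite normrM ler_piMr// indicE; case: (_ \in _); by rewrite ?normr1 ?normr0.
Qed.

Lemma integrable_term n G i j : mu2.-integrable sq
  (fun p => (G (i%:R / 2 ^+ n) (j%:R / 2 ^+ n) * \1_(cell n i `*` cell n j) p)%:E).
Proof.
apply: (@bounded_integrable_sq (fun p => _ * _) `|G (i%:R / 2 ^+ n) (j%:R / 2 ^+ n)|).
  apply: measurable_funM; first exact: measurable_cst.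
  by apply: measurable_indic; apply: measurableX; exact: measurable_cell.
move=> p _; rewrite normrM ler_piMr// indicE; case: (_ \in _); by rewrite ?normr1 ?normr0.
Qed.

Lemma integral_step n G : (\int[mu2]_(p in sq) (step n G p)%:E = (riemann n G)%:E)%E.
Proof.
have msq := measurable_sq.
under eq_integral do rewrite /step -sumEFin.
rewrite integral_sum//; last first.
  move=> i; under eq_fun do rewrite -sumEFin.
  by apply: integrable_sum => // j _; exact: integrable_term.
rewrite /riemann big_distrl/= -sumEFin big_nat_cond [RHS]big_nat_cond.
apply: eq_bigr => i /andP[/andP[_ ni] _].
under eq_integral do rewrite -sumEFin.
rewrite integral_sum//; last by move=> j; exact: integrable_term.
rewrite big_distrl/= -sumEFin big_nat_cond [RHS]big_nat_cond.
apply: eq_bigr => j /andP[/andP[_ nj] _].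
have mc : measurable (cell n i `*` cell n j) by apply: measurableX; exact: measurable_cell.
under eq_integral do rewrite EFinM.
rewrite integralZl//; last first.
  apply: (@bounded_integrable_sq _ 1); first exact: measurable_indic.
  by move=> p _; rewrite indicE; case: (_ \in _); rewrite ?normr1 ?normr0.
rewrite integral_indic// setIidl; last first.
  move=> [x y] [/= xi yj]; split => /=; rewrite in_itv/=.
    by have [] := cell_bounds _ _ _ ni xi.
  by have [] := cell_bounds _ _ _ nj yj.
rewrite [X in (_ * X)%E](_ : _ = (mu (cell n i) * mu (cell n j))%E); last first.
  by apply: product_measure1E; exact: measurable_cell.
by rewrite !mu_cell -!EFinM expr2 invfM.
Qed.

Lemma half_pow_lt d : 0 < d -> exists n0, forall n, (n0 <= n)%N -> (2 ^+ n)^-1 <= d.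
Proof.
move=> d0; exists (Num.truncn d^-1).+1 => n n0n.
rewrite invf_ple ?posrE ?pow2_gt0//.
have /ltW := truncnS_gt d^-1; move/le_trans; apply.
by rewrite -natrX ler_nat (leq_trans n0n)// ltnW// ltn_expl.
Qed.

Lemma ucont2_step_near G : ucont2 G -> forall e, 0 < e -> exists n0, forall n,
  (n0 <= n)%N -> forall p, sq p -> `|G p.1 p.2 - step n G p| <= e.
Proof.
move=> uG e /uG[d d0 dG]; have [n0 n0P] := half_pow_lt _ d0.
by exists n0 => n /n0P nd; exact: step_close dG.
Qed.

(** Measurability comes from the approximating step functions; boundedness from staying within 1 of
    a single one of them. *)
Lemma ucont2_integrable G : ucont2 G -> mu2.-integrable sq (fun p => (G p.1 p.2)%:E).
Proof.
move=> uG.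
have mG : measurable_fun sq (fun p => G p.1 p.2).
  apply: (@measurable_fun_cvg _ _ _ _ (fun n => step n G)).
    by move=> n; exact: measurable_step.
  move=> p sp; apply/cvgrPdist_le => e e0.
  have [n0 n0P] := ucont2_step_near _ uG _ e0.
  by exists n0 => // n /= n0n; exact: n0P.
have [n0 n0P] := ucont2_step_near _ uG _ ltr01.
apply: (bounded_integrable_sq (fun p => G p.1 p.2)) mG _ => p sp.
rewrite -[G _ _](subrK (step n0 G p)); apply: le_trans (ler_normD _ _) _.
by apply: lerD; [exact: n0P|exact: step_bounded].
Qed.

Lemma riemann_near G : ucont2 G -> forall e, 0 < e -> exists n0, forall n,
  (n0 <= n)%N -> `|fine (\int[mu2]_(p in sq) (G p.1 p.2)%:E) - riemann n G| <= e.
Proof.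
move=> uG e e0; have [n0 n0P] := ucont2_step_near _ uG _ e0; exists n0 => n n0n.
have msq := measurable_sq.
have iG := ucont2_integrable _ uG.
have iS : mu2.-integrable sq (EFin \o step n G).
  by apply: bounded_integrable_sq; [exact: measurable_step|move=> p _; exact: step_bounded].
have -> : riemann n G = fine (\int[mu2]_(p in sq) (step n G p)%:E) by rewrite integral_step.
have -> : fine (\int[mu2]_(p in sq) (G p.1 p.2)%:E) - fine (\int[mu2]_(p in sq) (step n G p)%:E)
   = (\int[mu2]_(p in sq) (G p.1 p.2 - step n G p))%R by rewrite RintegralB.
have iB : mu2.-integrable sq (EFin \o (fun p => G p.1 p.2 - step n G p)).
  by apply: integrableB iG iS.
apply: le_trans (le_normr_Rintegral _ _) _ => //.
have -> : e = (\int[mu2]_(p in sq) e)%R.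
  by rewrite Rintegral_cst// [X in fine X](_ : _ = 1%:E) ?mulr1//; exact: mu2_sq.
apply: le_Rintegral => //.
- exact: integrable_norm iB.
- apply: (@bounded_integrable_sq (fun=> e) `|e|); first exact: measurable_cst.
  by [].
- by move=> p sp; exact: n0P.
Qed.

End Riemann.

(** * Dyadic cell bounds, the gap, and averages over the xor graph *)

Section Grid.
Implicit Types (J G : R -> R -> R) (g : R -> R -> R -> R) (n i j : nat) (x y z e d : R).

(** A discrete form of having xor as mixed derivative. [Ixor] and all three functions of an optimal
    triple share it. *)
Definition cell_bounded J := forall n i j, (i < 2 ^ n)%N -> (j < 2 ^ n)%N ->
  (lxor i j)%:R * ((2 ^+ n)^-1) ^+ 3 <=
  mdiff J (i%:R / 2 ^+ n) (i.+1%:R / 2 ^+ n) (j%:R / 2 ^+ n) (j.+1%:R / 2 ^+ n)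
  <= (lxor i j).+1%:R * ((2 ^+ n)^-1) ^+ 3.

Lemma mdiff_telescope J (u v : nat -> R) a b :
  mdiff J (u 0) (u a) (v 0) (v b) =
  \sum_(0 <= i < a) \sum_(0 <= j < b) mdiff J (u i) (u i.+1) (v j) (v j.+1).
Proof.
have row x x' k : mdiff J x x' (v 0) (v k) =
    \sum_(0 <= j < k) mdiff J x x' (v j) (v j.+1).
  elim: k => [|k IH]; first by rewrite big_nil /mdiff; ring.
  by rewrite big_nat_recr//= -IH /mdiff; ring.
elim: a => [|a IH]; first by rewrite big_nil /mdiff; ring.
by rewrite big_nat_recr//= -IH -row /mdiff; ring.
Qed.

(** The midpoint of the bounds is off by at most [h ^+ 3 / 2] on each cell, and there are at most
    [4 ^ n] cells. *)
Lemma mdiff_grid J n a b : cell_bounded J -> (a <= 2 ^ n)%N -> (b <= 2 ^ n)%N ->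
  `|mdiff J 0 (a%:R / 2 ^+ n) 0 (b%:R / 2 ^+ n) - xor_sum a b * ((2 ^+ n)^-1) ^+ 3|
    <= (2 ^+ n)^-1 / 2.
Proof.
move=> cJ an bn; set h := (2 ^+ n)^-1.
have p0 := pow2_gt0 n; have h0 : 0 < h by rewrite invr_gt0.
have := mdiff_telescope J (fun k => k%:R * h) (fun k => k%:R * h) a b.
rewrite !mul0r => ->; rewrite /xor_sum big_distrl/= -sumrB.
have le1 k : (k <= 2 ^ n)%N -> k%:R * h <= 1 by move=> /grid01/andP[].
apply: le_trans (_ : a%:R * (b%:R * (h ^+ 3 / 2)) <= _); last first.
  have -> : a%:R * (b%:R * (h ^+ 3 / 2)) = (a%:R * h) * (b%:R * h) * (h / 2) by field.
  rewrite ler_piMl ?divr_ge0 ?(ltW h0)//.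
  by rewrite mulr_ile1 ?le1// mulr_ge0 ?(ltW h0).
have -> : a%:R * (b%:R * (h ^+ 3 / 2)) = \sum_(0 <= i < a) (b%:R * (h ^+ 3 / 2)).
  by rewrite sumr_const_nat subn0 [LHS]mulr_natl.
apply: le_trans (ler_norm_sum _ _ _) _.
rewrite big_nat_cond [leRHS]big_nat_cond.
apply: ler_sum => i /andP[/andP[_ ia] _].
rewrite big_distrl/= -sumrB.
have -> : b%:R * (h ^+ 3 / 2) = \sum_(0 <= i < b) (h ^+ 3 / 2).
  by rewrite sumr_const_nat subn0 [LHS]mulr_natl.
apply: le_trans (ler_norm_sum _ _ _) _.
rewrite big_nat_cond [leRHS]big_nat_cond.
apply: ler_sum => j /andP[/andP[_ jb] _].
have /andP[] := cJ n i j (leq_trans ia an) (leq_trans jb bn).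
rewrite -/h -natr1 ler_norml; move: (mdiff _ _ _ _ _) (h ^+ 3) => m t; lra.
Qed.

Lemma dyadic_approx n x : 0 <= x <= 1 ->
  exists2 i, (i < 2 ^ n)%N & `|x - i%:R / 2 ^+ n| <= (2 ^+ n)^-1.
Proof.
move=> x01; have [i ni iP] := cell_ex n x x01; exists i => //.
by have /set_mem/(cell_bounds _ _ _ ni)[] : x \in cell n i by rewrite iP.
Qed.

Definition ucont3 g := forall e, 0 < e -> exists2 d, 0 < d &
  forall x y z x' y' z', 0 <= x <= 1 -> 0 <= y <= 1 -> 0 <= z <= 1 ->
  0 <= x' <= 1 -> 0 <= y' <= 1 -> 0 <= z' <= 1 ->
  `|x - x'| <= d -> `|y - y'| <= d -> `|z - z'| <= d -> `|g x y z - g x' y' z'| <= e.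

Definition gap (A B C : R -> R -> R) x y z := x * y * z - (A x y + B x z + C y z).

Lemma ucont3_gap A B C : ucont2 A -> ucont2 B -> ucont2 C -> ucont3 (gap A B C).
Proof.
move=> uA uB uC e e0.
have e40 : 0 < e / 4 by rewrite divr_gt0.
have [a a0 aP] := uA _ e40; have [b b0 bP] := uB _ e40; have [c c0 cP] := uC _ e40.
(* The budget is a quarter of [e] for each function and for the product, whose three increments get
   [e / 12] each. *)
exists (Num.min (e / 12) (Num.min a (Num.min b c))).
  by rewrite !lt_min a0 b0 c0 divr_gt0.
move=> x y z x' y' z' x01 y01 z01 x'01 y'01 z'01.
rewrite !le_min => /and4P[xe xa xb xc] /and4P[ye ya yb yc] /and4P[ze za zb zc].
have A1 := aP _ _ _ _ x01 y01 x'01 y'01 xa ya.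
have B1 := bP _ _ _ _ x01 z01 x'01 z'01 xb zb.
have C1 := cP _ _ _ _ y01 z01 y'01 z'01 yc zc.
have P1 : `|x * y * z - x' * y' * z'| <= e / 4.
  have -> : x * y * z - x' * y' * z' =
    (x - x') * (y * z) + ((y - y') * (x' * z) + (z - z') * (x' * y')) by ring.
  have T s u v : `|s| <= e / 12 -> 0 <= u <= 1 -> 0 <= v <= 1 -> `|s * (u * v)| <= e / 12.
    move=> se /andP[u0 u1] /andP[v0 v1]; rewrite normrM (@ger0_norm _ (u * v)) ?mulr_ge0//.
    by apply: le_trans se; rewrite ler_piMr// mulr_ile1.
  apply: le_trans (ler_normD _ _) _.
  have := T _ _ _ xe y01 z01.
  have := ler_normD ((y - y') * (x' * z)) ((z - z') * (x' * y')).
  have := T _ _ _ ye x'01 z01; have := T _ _ _ ze x'01 y'01; lra.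
rewrite /gap (_ : _ - _ = (x * y * z - x' * y' * z') - ((A x y - A x' y') +
  ((B x z - B x' z') + (C y z - C y' z')))); last by ring.
apply: le_trans (ler_normB _ _) _.
have := ler_normD (A x y - A x' y') ((B x z - B x' z') + (C y z - C y' z')).
have := ler_normD (B x z - B x' z') (C y z - C y' z'); lra.
Qed.

(** Discrete integration against the uniform measure on the closure of the xor graph. *)
Definition gsum n g : R := (\sum_(0 <= i < 2 ^ n) \sum_(0 <= j < 2 ^ n)
  g (i%:R / 2 ^+ n) (j%:R / 2 ^+ n) ((lxor i j)%:R / 2 ^+ n)) / (2 ^+ n) ^+ 2.

(* Each pair of coordinates of (i, j, i xor j) runs once through the grid. *)
Lemma gsum_pairs n A B C : gsum n (fun x y z => A x y + B x z + C y z) =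
  riemann n A + riemann n B + riemann n C.
Proof.
rewrite /gsum /riemann -!mulrDl; congr (_ / _).
under eq_bigr do rewrite !big_split/=.
rewrite !big_split/=; congr (_ + _ + _).
  apply: eq_big_nat => i /andP[_ ni].
  under eq_bigr do rewrite Nat.lxor_comm.
  by rewrite (sum_lxor n i (fun k => B _ (k%:R / _))).
rewrite exchange_big/= [RHS](eq_big_nat _ _ (F2 := fun j => \sum_(0 <= i < 2 ^ n)
  C (j%:R / 2 ^+ n) ((lxor i j)%:R / 2 ^+ n)))//.
by move=> j /andP[_ nj]; rewrite (sum_lxor n j (fun k => C _ (k%:R / _))).
Qed.

Lemma gsum_le n g M : (forall i j, (i < 2 ^ n)%N -> (j < 2 ^ n)%N ->
    g (i%:R / 2 ^+ n) (j%:R / 2 ^+ n) ((lxor i j)%:R / 2 ^+ n) <= M) ->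
  gsum n g <= M.
Proof.
move=> gM; have p0 := pow2_gt0 n.
rewrite ler_pdivrMr ?exprn_gt0//.
apply: le_trans (_ : \sum_(0 <= i < 2 ^ n) \sum_(0 <= j < 2 ^ n) M <= _).
  rewrite big_nat_cond [leRHS]big_nat_cond.
  apply: ler_sum => i /andP[/andP[_ ni] _].
  rewrite big_nat_cond [leRHS]big_nat_cond.
  by apply: ler_sum => j /andP[/andP[_ nj] _]; exact: gM.
by rewrite !sumr_const_nat !subn0 -mulrnA -[leLHS]mulr_natr natrM natrX expr2.
Qed.

Lemma subsum_le (f : nat -> R) m a M : (a + m <= M)%N -> (forall i, (i < M)%N -> 0 <= f i) ->
  \sum_(0 <= i < m) f (a + i)%N <= \sum_(0 <= i < M) f i.
Proof.
move=> amM f0; rewrite -(subnKC amM) !sum_split -addrA.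
rewrite addrCA lerDl addr_ge0//.
  rewrite big_nat_cond sumr_ge0// => i /andP[/andP[_ ia] _].
  by apply: f0; apply: leq_trans amM; rewrite ltn_addr.
rewrite big_nat_cond sumr_ge0// => i /andP[/andP[_ ia] _].
by apply: f0; lia.
Qed.

(** Of the [4 ^ q] equal blocks of grid points one lies in the given cell, and its share of the
    average does not depend on the refinement [r]. *)
Lemma gsum_ge_block q r i0 j0 g e : (i0 < 2 ^ q)%N -> (j0 < 2 ^ q)%N ->
  (forall x y z, 0 <= x <= 1 -> 0 <= y <= 1 -> 0 <= z <= 1 -> 0 <= g x y z) ->
  (forall x y z, 0 <= x <= 1 -> 0 <= y <= 1 -> 0 <= z <= 1 ->
    `|x - i0%:R / 2 ^+ q| <= (2 ^+ q)^-1 -> `|y - j0%:R / 2 ^+ q| <= (2 ^+ q)^-1 ->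
    `|z - (lxor i0 j0)%:R / 2 ^+ q| <= (2 ^+ q)^-1 -> e <= g x y z) ->
  e / (2 ^+ q) ^+ 2 <= gsum (q + r) g.
Proof.
move=> iq jq g0 ge.
have block k k' : (k < 2 ^ q -> k' < 2 ^ r -> k * 2 ^ r + k' < 2 ^ (q + r))%N.
  move=> kq kr; rewrite expnD; apply: leq_trans (_ : k.+1 * 2 ^ r <= _)%N; last first.
    by rewrite leq_mul2r kq orbT.
  by rewrite mulSn addnC ltn_add2r.
have blocks k : (k < 2 ^ q -> k * 2 ^ r + 2 ^ r <= 2 ^ (q + r))%N.
  by move=> kq; rewrite expnD addnC -mulSn leq_mul2r kq orbT.
have pq := pow2_gt0 q; have pr := pow2_gt0 r.
have near k k' : (k' < 2 ^ r)%N ->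
    `|(k * 2 ^ r + k')%:R / 2 ^+ (q + r) - k%:R / 2 ^+ q| <= (2 ^+ q)^-1 :> R.
  move=> kr; rewrite natrD natrM natrX exprD.
  have -> : (k%:R * 2 ^+ r + k'%:R) / (2 ^+ q * 2 ^+ r) - k%:R / 2 ^+ q =
    (2 ^+ q)^-1 * (k'%:R / 2 ^+ r) :> R by field; rewrite !gt_eqF.
  rewrite ger0_norm ?mulr_ge0 ?invr_ge0 ?(ltW pq) ?(ltW pr)//.
  by rewrite ler_piMr ?invr_ge0 ?(ltW pq)//; have /andP[] := grid01 r k' (ltnW kr).
rewrite ler_pdivlMr ?exprn_gt0 ?pow2_gt0//.
apply: le_trans (_ : \sum_(0 <= i < 2 ^ r) \sum_(0 <= j < 2 ^ r) e <= _).
  rewrite !sumr_const_nat !subn0 -mulrnA -[leRHS]mulr_natr natrM !natrX exprD.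
  by rewrite le_eqVlt; apply/orP; left; apply/eqP; field; rewrite gt_eqF.
apply: le_trans (subsum_le _ (2 ^ r) (i0 * 2 ^ r) _ (blocks _ iq) _); last first.
  move=> i ni; rewrite big_nat_cond sumr_ge0// => j /andP[/andP[_ nj] _].
  by apply: g0; apply: grid01; rewrite ltnW// lxor_lt.
rewrite big_nat_cond [leRHS]big_nat_cond.
apply: ler_sum => i /andP[/andP[_ ni] _].
apply: le_trans (subsum_le _ (2 ^ r) (j0 * 2 ^ r) _ (blocks _ jq) _); last first.
  move=> j nj; apply: g0; apply: grid01; rewrite ltnW ?block// lxor_lt// block//.
rewrite big_nat_cond [leRHS]big_nat_cond.
apply: ler_sum => j /andP[/andP[_ nj] _].
(* Xor acts separately on block index and position in the block, so the third coordinate stays in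
   the cell of [lxor i0 j0]. *)
rewrite lxor_split//; apply: ge; [| | |exact: near|exact: near|].
- by apply: grid01; rewrite ltnW ?block.
- by apply: grid01; rewrite ltnW ?block.
- by apply: grid01; rewrite ltnW ?block ?lxor_lt.
- by apply: near; rewrite lxor_lt.
Qed.

End Grid.

(** * Optimality forces zero gap on the support, hence the cell bounds *)

Section Dual.
Implicit Types (J A B C : R -> R -> R) (n i j : nat) (x y z e d : R).
Local Notation mu := (@lebesgue_measure R).
Local Notation mu2 := (mu \x mu)%E.
Local Notation sq := (unit_sq R).

(** This is [fxor] when [J] is [Ixor]. *)
Definition diag_corrected J x y := J x y - 4^-1 * J x x - 4^-1 * J y y.

(** Six values of [J] enter, each known within [h / 2]: three with weight 1 and three diagonal ones
    with weight 1/2. The total error is [9 * h / 4]. *)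
Lemma gap_grid J n a b c (F := diag_corrected J) (h := (2 ^+ n)^-1) :
  (forall y, J 0 y = 0) -> (forall x, 0 <= x -> J x 0 = 0) ->
  cell_bounded J -> (a <= 2 ^ n)%N -> (b <= 2 ^ n)%N -> (c <= 2 ^ n)%N ->
  `|gap F F F (a%:R * h) (b%:R * h) (c%:R * h) - xor_defect a b c * h ^+ 3| <= 3 * h.
Proof.
move=> J0l J0r cJ an bn cn.
have h0 : 0 < h by rewrite invr_gt0 pow2_gt0.
have apx k l : (k <= 2 ^ n)%N -> (l <= 2 ^ n)%N ->
    `|J (k%:R * h) (l%:R * h) - xor_sum k l * h ^+ 3| <= h / 2.
  move=> kn ln; have /andP[k0 _] := grid01 _ _ kn.
  have := mdiff_grid _ _ _ _ cJ kn ln.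
  by rewrite /mdiff !J0l (J0r _ k0) !(subr0, addr0).
have := apx _ _ an bn; have := apx _ _ an cn; have := apx _ _ bn cn.
have := apx _ _ an an; have := apx _ _ bn bn; have := apx _ _ cn cn.
rewrite /gap /F /diag_corrected.
move: (J _ _) (J _ _) (J _ _) (J _ _) (J _ _) (J _ _) => cc bb aa bc ac ab.
rewrite /xor_defect; move: (xor_sum _ _) (xor_sum _ _) (xor_sum _ _) (xor_sum _ _) (xor_sum _ _) (xor_sum _ _)
  => s1 s2 s3 s4 s5 s6.
rewrite !ler_norml; lra.
Qed.

Lemma gap_ge0 J (F := diag_corrected J) :
  (forall y, J 0 y = 0) -> (forall x, 0 <= x -> J x 0 = 0) ->
  cell_bounded J -> ucont2 F ->
  forall x y z, 0 <= x <= 1 -> 0 <= y <= 1 -> 0 <= z <= 1 -> 0 <= gap F F F x y z.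
Proof.
move=> J0l J0r cJ uF x y z x01 y01 z01.
rewrite leNgt; apply/negP => g0.
(* A grid point nearby has gap at least [- 3 * e], and moving there costs [e]; so the gap would be
   at least [- 4 * e], half of its own negative value. *)
pose e := - gap F F F x y z / 8.
have e0 : 0 < e by rewrite divr_gt0// oppr_gt0.
have [d d0 dP] := ucont3_gap _ _ _ uF uF uF _ e0.
have [n2 n2P] := half_pow_lt _ e0.
have [n3 n3P] := half_pow_lt _ d0.
pose n := maxn n2 n3.
have hd := n3P n (leq_maxr _ _); have he := n2P n (leq_maxl _ _).
have [i ni xi] := dyadic_approx n x x01.
have [j nj yj] := dyadic_approx n y y01.
have [k nk zk] := dyadic_approx n z z01.
have h0 : 0 < (2 ^+ n)^-1 :> R by rewrite invr_gt0 pow2_gt0.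
have := dP x y z _ _ _ x01 y01 z01 (grid01 _ _ (ltnW ni)) (grid01 _ _ (ltnW nj))
  (grid01 _ _ (ltnW nk)) (le_trans xi hd) (le_trans yj hd) (le_trans zk hd).
have := gap_grid J n i j k J0l J0r cJ (ltnW ni) (ltnW nj) (ltnW nk).
have : 0 <= xor_defect i j k * (2 ^+ n)^-1 ^+ 3.
  by rewrite mulr_ge0 ?xor_defect_ge0// exprn_ge0// ltW.
rewrite /= -/F; move: (xor_defect i j k * _) he e0; rewrite /e.
move: (gap _ _ _ _ _ _) (gap _ _ _ _ _ _) => u v w.
rewrite !ler_norml; lra.
Qed.

Lemma gsum_gap_le J n (F := diag_corrected J) :
  (forall y, J 0 y = 0) -> (forall x, 0 <= x -> J x 0 = 0) ->
  cell_bounded J ->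
  gsum n (gap F F F) <= 3 * (2 ^+ n)^-1.
Proof.
move=> J0l J0r cJ; apply: gsum_le => i j ni nj.
have := gap_grid J n i j (lxor i j) J0l J0r cJ (ltnW ni) (ltnW nj) (ltnW (lxor_lt _ _ _ ni nj)).
by rewrite /= xor_defect_xor mul0r subr0 ler_norml => /andP[].
Qed.

Definition int_sq A : R := fine (\int[mu2]_(p in sq) (A p.1 p.2)%:E)%E.

(** The average of the cost is common to all triples, so comparing gaps amounts to comparing Riemann
    sums. *)
Lemma gsum_gap n A B C : gsum n (gap A B C) =
  gsum n (fun x y z => x * y * z) - (riemann n A + riemann n B + riemann n C).
Proof.
rewrite -gsum_pairs /gsum -mulrBl -sumrB; congr (_ / _).
by apply: eq_bigr => i _; rewrite -sumrB.
Qed.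

Lemma gsum_gap_lim J A B C (F := diag_corrected J) :
  (forall y, J 0 y = 0) -> (forall x, 0 <= x -> J x 0 = 0) ->
  cell_bounded J -> ucont2 F ->
  ucont2 A -> ucont2 B -> ucont2 C ->
  int_sq F + int_sq F + int_sq F <= int_sq A + int_sq B + int_sq C ->
  forall e, 0 < e -> exists n0, forall n, (n0 <= n)%N -> gsum n (gap A B C) <= e.
Proof.
move=> J0l J0r cJ uF uA uB uC le_int e e0.
(* Nine errors occur: three from the mesh bound, three from [F], and one each from [A], [B], [C]. *)
have e9 : 0 < e / 9 by rewrite divr_gt0.
have [nF FP] := riemann_near _ uF _ e9.
have [nA AP] := riemann_near _ uA _ e9.
have [nB BP] := riemann_near _ uB _ e9.
have [nC CP] := riemann_near _ uC _ e9.
have [nh hP] := half_pow_lt _ e9.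
exists (nF + nA + nB + nC + nh)%N => n nn.
have h1 := hP n ltac:(lia); have h2 := FP n ltac:(lia).
have h3 := AP n ltac:(lia); have h4 := BP n ltac:(lia); have h5 := CP n ltac:(lia).
have := gsum_gap_le J n J0l J0r cJ; rewrite -/F !gsum_gap.
move: h1 h2 h3 h4 h5 le_int; rewrite -!/(int_sq _) !ler_norml.
move: (int_sq _) (int_sq _) (int_sq _) (int_sq _) (gsum _ _) (riemann _ _) (riemann _ _)
  (riemann _ _) (riemann _ _) => *; lra.
Qed.

(* The support of the optimal plan: the closure of the graph of xor (a Sierpinski
   tetrahedron), described by its dyadic cells. *)
Definition xor_support x y z := forall d, 0 < d -> exists q i j,
  [/\ (i < 2 ^ q)%N, (j < 2 ^ q)%N & [/\ (2 ^+ q)^-1 <= d, `|x - i%:R / 2 ^+ q| <= d,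
   `|y - j%:R / 2 ^+ q| <= d & `|z - (lxor i j)%:R / 2 ^+ q| <= d]].

Lemma gap_support A B C : ucont2 A -> ucont2 B -> ucont2 C ->
  (forall x y z, 0 <= x <= 1 -> 0 <= y <= 1 -> 0 <= z <= 1 -> 0 <= gap A B C x y z) ->
  (forall e, 0 < e -> exists n0, forall n, (n0 <= n)%N -> gsum n (gap A B C) <= e) ->
  forall x y z, 0 <= x <= 1 -> 0 <= y <= 1 -> 0 <= z <= 1 -> xor_support x y z ->
  gap A B C x y z = 0.
Proof.
move=> uA uB uC g0 glim x y z x01 y01 z01 sxyz.
apply/eqP; rewrite eq_le g0// andbT leNgt; apply/negP => gpos.
have e20 : 0 < gap A B C x y z / 2 by rewrite divr_gt0.
have [d d0 dP] := ucont3_gap _ _ _ uA uB uC _ e20.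
have d20 : 0 < d / 2 by rewrite divr_gt0.
have [q [i [j [iq jq [qd xi yj zk]]]]] := sxyz _ d20.
have c0 : 0 < gap A B C x y z / 2 / (2 ^+ q) ^+ 2 / 2.
  by rewrite !divr_gt0// exprn_gt0// pow2_gt0.
have [n0 /(_ (q + n0)%N (leq_addl _ _))] := glim _ c0.
have := gsum_ge_block q n0 i j (gap A B C) (gap A B C x y z / 2) iq jq g0.
have near (u v w : R) : `|u - w| <= d / 2 -> `|v - w| <= (2 ^+ q)^-1 -> `|u - v| <= d.
  move=> uw vw; rewrite (_ : u - v = (u - w) - (v - w)); last by ring.
  by apply: le_trans (ler_normB _ _) _; lra.
move=> h; have {}h : gap A B C x y z / 2 / (2 ^+ q) ^+ 2 <= gsum (q + n0) (gap A B C).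
  apply: h => u v w u01 v01 w01 ui vj wk.
  have := dP x y z u v w x01 y01 z01 u01 v01 w01
    (near _ _ _ xi ui) (near _ _ _ yj vj) (near _ _ _ zk wk).
  rewrite ler_norml; move: (gap _ _ _ _ _ _) (gap _ _ _ _ _ _) => s t; lra.
move: h c0; move: (_ / (2 ^+ q) ^+ 2) (gsum _ _) => s t; lra.
Qed.

Lemma xor_support_cell n i j (s t : bool) : (i < 2 ^ n)%N -> (j < 2 ^ n)%N ->
  xor_support ((i + s)%:R / 2 ^+ n) ((j + t)%:R / 2 ^+ n)
    ((lxor i j + (s (+) t))%:R / 2 ^+ n).
Proof.
move=> ni nj d d0; have [r0 r0P] := half_pow_lt _ d0.
pose r := r0.+1; exists (n + r)%N.
(* Low bits that are all ones approach the upper corner from below, all zeros the lower one, and the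
   two patterns are closed under xor. *)
pose low (b : bool) := if b then (2 ^ r).-1 else 0%N.
have low_lt b : (low b < 2 ^ r)%N by case: b => /=; rewrite ?prednK ?expn_gt0.
have low_xor b b' : lxor (low b) (low b') = low (b (+) b').
  by case: b; case: b' => /=; rewrite ?Nat.lxor_nilpotent ?Nat.lxor_0_r ?Nat.lxor_0_l.
have pn := pow2_gt0 n; have pr := pow2_gt0 r.
have hr : (2 ^+ (n + r))^-1 <= d by apply: r0P; rewrite /r; lia.
have near k (b : bool) : `|(k + b)%:R / 2 ^+ n - (k * 2 ^ r + low b)%:R / 2 ^+ (n + r)| <= d.
  apply: le_trans hr.
  have -> : (k + b)%:R / 2 ^+ n - (k * 2 ^ r + low b)%:R / 2 ^+ (n + r) =
      b%:R / 2 ^+ (n + r) :> R.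
    rewrite !natrD natrM natrX exprD.
    have -> : (low b)%:R = b%:R * (2 ^+ r - 1) :> R.
      case: b => /=; last by rewrite mul0r.
      by rewrite -subn1 natrB ?expn_gt0// natrX mul1r.
    by field; rewrite !gt_eqF.
  rewrite ger0_norm ?divr_ge0 ?(ltW (pow2_gt0 _ _))//.
  by rewrite ler_piMl ?invr_ge0 ?(ltW (pow2_gt0 _ _))//; case: b; rewrite ?ler01.
have cell_lt k b : (k < 2 ^ n)%N -> (k * 2 ^ r + low b < 2 ^ (n + r))%N.
  move=> kn; rewrite expnD; apply: leq_trans (_ : k.+1 * 2 ^ r <= _)%N; last first.
    by rewrite leq_mul2r kn orbT.
  by rewrite mulSn addnC ltn_add2r.
exists (i * 2 ^ r + low s)%N, (j * 2 ^ r + low t)%N; split; [exact: cell_lt..|].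
by split => //; rewrite lxor_split// low_xor.
Qed.

Lemma xor_support_diag x : 0 <= x <= 1 ->
  [/\ xor_support 0 x x, xor_support x 0 x & xor_support x x 0].
Proof.
move=> x01; split => d /half_pow_lt[n /(_ n (leqnn n)) nd];
  have [i ni xi] := dyadic_approx n x x01; exists n.
- exists 0%N, i; rewrite expn_gt0 mul0r subrr normr0 Nat.lxor_0_l; split => //.
  by split; rewrite ?(le_trans xi)// (le_trans _ nd)// invr_ge0 ltW// pow2_gt0.
- exists i, 0%N; rewrite expn_gt0 mul0r subrr normr0 Nat.lxor_0_r; split => //.
  by split; rewrite ?(le_trans xi)// (le_trans _ nd)// invr_ge0 ltW// pow2_gt0.
- exists i, i; rewrite Nat.lxor_nilpotent mul0r subrr normr0; split => //.
  by split; rewrite ?(le_trans xi)// (le_trans _ nd)// invr_ge0 ltW// pow2_gt0.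
Qed.

(** At the lower height, the two vertices with equality and the two other corners carry the same
    values of [B] and [C], which cancel and leave the lower bound. The upper height gives the upper
    bound. *)
Lemma cell_bounded_of_gap A B C :
  (forall x y z, 0 <= x <= 1 -> 0 <= y <= 1 -> 0 <= z <= 1 -> 0 <= gap A B C x y z) ->
  (forall x y z, 0 <= x <= 1 -> 0 <= y <= 1 -> 0 <= z <= 1 -> xor_support x y z ->
     gap A B C x y z = 0) ->
  cell_bounded A.
Proof.
move=> g0 gS n i j ni nj; have nk := lxor_lt _ _ _ ni nj.
have V s t := xor_support_cell n i j s t ni nj.
have b01 k (b : bool) : (k < 2 ^ n)%N -> (0 : R) <= ((k + b)%:R / 2 ^+ n : R) <= 1.
  by move=> kn; apply: grid01; case: b; rewrite ?addn1 ?addn0// ltnW.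
have Z s t := gS _ _ _ (b01 i s ni) (b01 j t nj) (b01 _ (s (+) t) nk) (V s t).
have P s t u := g0 _ _ _ (b01 i s ni) (b01 j t nj) (b01 _ u nk).
have h0 : 0 < (2 ^+ n)^-1 :> R by rewrite invr_gt0 pow2_gt0.
have := Z true true; have := Z false false; have := Z true false; have := Z false true.
have := P true false false; have := P false true false.
have := P true true true; have := P false false true.
rewrite /= !addn0 !addn1 /gap /mdiff -!natr1 !mulrDl !mul1r.
clear; move: (2 ^+ n : R)^-1 (i%:R : R) (j%:R : R) ((lxor i j)%:R : R) => h a b k.
move: (A _ _) (A _ _) (A _ _) (A _ _) (B _ _) (B _ _) (B _ _) (B _ _)
  (C _ _) (C _ _) (C _ _) (C _ _) => *; lra.
Qed.

End Dual.

(** * Uniqueness of mixed differences and the one-variable potentials *)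

Section Uniqueness.
Implicit Types (J A B C : R -> R -> R) (n i j : nat) (x y z t e d : R).

(** At grid points both sides are close to the same multiple of [xor_sum]; density of the grids and
    continuity do the rest. *)
Lemma cell_bounded_unique A B : cell_bounded A -> cell_bounded B ->
  ucont2 A -> ucont2 B -> forall x y, 0 <= x <= 1 -> 0 <= y <= 1 ->
  mdiff A 0 x 0 y = mdiff B 0 x 0 y.
Proof.
move=> cA cB uA uB x y x01 y01; apply/eqP; rewrite -subr_eq0 -normr_eq0.
rewrite eq_le normr_ge0 andbT leNgt; apply/negP => v0.
pose v := `|mdiff A 0 x 0 y - mdiff B 0 x 0 y|.
(* Moving to the grid costs [3 * (v / 16)] per function, since the corner at the origin stays fixed,
   and the grid estimate at most [v / 32] each; the total is below [v]. *)
have e0 : 0 < v / 16 by rewrite divr_gt0.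
have [a a0 aP] := uA _ e0; have [b b0 bP] := uB _ e0.
have [na naP] := half_pow_lt _ a0; have [nb nbP] := half_pow_lt _ b0.
have [ne neP] := half_pow_lt _ e0.
pose n := (na + nb + ne)%N.
have ha := naP n ltac:(rewrite /n; lia); have hb := nbP n ltac:(rewrite /n; lia).
have he := neP n ltac:(rewrite /n; lia).
have [i ni xi] := dyadic_approx n x x01.
have [j nj yj] := dyadic_approx n y y01.
have i01 := grid01 _ _ (ltnW ni); have j01 := grid01 _ _ (ltnW nj).
have z01 : (0 : R) <= (0 : R) <= 1 by rewrite lexx ler01.
have zz : `|(0 : R) - 0| <= (2 ^+ n)^-1 by rewrite subrr normr0 invr_ge0 ltW// pow2_gt0.
have cmp J d : (2 ^+ n)^-1 <= d ->
  (forall x y x' y', 0 <= x <= 1 -> 0 <= y <= 1 -> 0 <= x' <= 1 -> 0 <= y' <= 1 ->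
    `|x - x'| <= d -> `|y - y'| <= d -> `|J x y - J x' y'| <= v / 16) ->
  `|mdiff J 0 x 0 y - mdiff J 0 (i%:R / 2 ^+ n) 0 (j%:R / 2 ^+ n)| <= 3 * (v / 16).
  move=> nd JP; rewrite /mdiff.
  have := JP _ _ _ _ x01 y01 i01 j01 (le_trans xi nd) (le_trans yj nd).
  have := JP _ _ _ _ x01 z01 i01 z01 (le_trans xi nd) (le_trans zz nd).
  have := JP _ _ _ _ z01 y01 z01 j01 (le_trans zz nd) (le_trans yj nd).
  move: (J _ _) (J _ _) (J _ _) (J _ _) (J _ _) (J _ _) (J _ _) => ? ? ? ? ? ? ?.
  by move: (v / 16) => w; rewrite !ler_norml; lra.
have := cmp _ _ ha aP; have := cmp _ _ hb bP.
have := mdiff_grid _ _ _ _ cA (ltnW ni) (ltnW nj).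
have := mdiff_grid _ _ _ _ cB (ltnW ni) (ltnW nj).
have vE : v = `|mdiff A 0 x 0 y - mdiff B 0 x 0 y| by [].
move: (v) vE e0 he {cmp aP bP neP}.
move: (mdiff A 0 x 0 y) (mdiff B 0 x 0 y) (mdiff A 0 (_ / _) 0 _) (mdiff B 0 (_ / _) 0 _) (xor_sum _ _ * _)
  => p q r s w {}v vE e0 he.
have : v <= p - q \/ v <= q - p.
  rewrite vE; case: (leP 0 (p - q)) => h; [left|right].
    by rewrite ger0_norm.
  by rewrite ltr0_norm// opprB.
by rewrite !ler_norml; case; lra.
Qed.

Definition ucont1 (f : R -> R) := forall e, 0 < e -> exists2 d, 0 < d &
  forall x y, 0 <= x <= 1 -> 0 <= y <= 1 -> `|x - y| <= d -> `|f x - f y| <= e.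

(** Serves for the slices [A x 0] and [A 0 x] and for the diagonal [J x x]. *)
Lemma ucont1_comp A (u v : R -> R) : ucont2 A ->
  (forall x, 0 <= x <= 1 -> 0 <= u x <= 1) -> (forall x, 0 <= x <= 1 -> 0 <= v x <= 1) ->
  (forall x y, `|u x - u y| <= `|x - y|) -> (forall x y, `|v x - v y| <= `|x - y|) ->
  ucont1 (fun x => A (u x) (v x)).
Proof.
move=> uA u01 v01 ul vl e /uA[d d0 dP]; exists d => // x y x01 y01 xy.
by apply: dP; rewrite ?u01 ?v01//; [apply: le_trans (ul _ _) _|apply: le_trans (vl _ _) _].
Qed.

Lemma ucont1_affine (f g : R -> R) (a b c : R) : ucont1 f -> ucont1 g ->
  ucont1 (fun x => a * f x + b * g x + c).
Proof.
(* The added 1 keeps [m] positive when both coefficients vanish. *)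
move=> uf ug e e0; pose m := 2 * (`|a| + `|b| + 1).
have m0 : 0 < m by rewrite /m mulr_gt0// ltr_wpDl// addr_ge0.
have em0 : 0 < e / m by rewrite divr_gt0.
have [d d0 dP] := uf _ em0; have [d' d'0 d'P] := ug _ em0.
exists (Num.min d d'); first by rewrite lt_min d0.
move=> x y x01 y01; rewrite le_min => /andP[xd xd'].
rewrite (_ : _ - _ = a * (f x - f y) + b * (g x - g y)); last by ring.
apply: le_trans (ler_normD _ _) _; rewrite !normrM.
have h1 : `|a| * `|f x - f y| <= `|a| * (e / m) by rewrite ler_wpM2l ?dP.
have h2 : `|b| * `|g x - g y| <= `|b| * (e / m) by rewrite ler_wpM2l ?d'P.
have E : e = m * (e / m) by rewrite mulrCA divff ?mulr1 ?gt_eqF.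
have a0 := mulr_ge0 (normr_ge0 a) (ltW em0).
have b0 := mulr_ge0 (normr_ge0 b) (ltW em0).
move: (e / m) em0 h1 h2 a0 b0 E => w ? ? ? ? ?; rewrite /m => ?; lra.
Qed.

Section Potentials.
Variables (J A B C : R -> R -> R).
Hypothesis (J0l : forall y, J 0 y = 0) (J0r : forall x, 0 <= x -> J x 0 = 0).
Hypothesis (JA : forall x y, 0 <= x <= 1 -> 0 <= y <= 1 -> mdiff A 0 x 0 y = J x y).
Hypothesis (JB : forall x y, 0 <= x <= 1 -> 0 <= y <= 1 -> mdiff B 0 x 0 y = J x y).
Hypothesis (JC : forall x y, 0 <= x <= 1 -> 0 <= y <= 1 -> mdiff C 0 x 0 y = J x y).
Hypothesis gap_diag : forall t, 0 <= t <= 1 ->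
  [/\ gap A B C 0 t t = 0, gap A B C t 0 t = 0 & gap A B C t t 0 = 0].

(** The potentials have the shape of [ucont1_affine]. The first two are read off from
    [A x y = J x y + A x 0 + A 0 y - A 0 0]. *)
Definition pot1 x := 1 * A x 0 + 4^-1 * J x x + 0.
Definition pot2 x := -1 * A 0 x + - 4^-1 * J x x + A 0 0.
Definition pot3 x := 1 * B 0 x + 4^-1 * J x x + A 0 0.

(** Adding the equalities at [(t,t,0)] and [(t,0,t)] and subtracting the one at [(0,t,t)] gives [A t
    0 + B t 0 = A 0 0 + B 0 0 - J t t / 2]. Splitting this half evenly explains the coefficient
    1/4. *)
Lemma potentials x y z : 0 <= x <= 1 -> 0 <= y <= 1 -> 0 <= z <= 1 ->
  [/\ A x y = diag_corrected J x y + pot1 x - pot2 y,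
      C y z = diag_corrected J y z + pot2 y - pot3 z &
      B x z = diag_corrected J x z + pot3 z - pot1 x].
Proof.
move=> x01 y01 z01.
have o01 : (0 : R) <= (0 : R) <= 1 by rewrite lexx ler01.
have E t : 0 <= t <= 1 ->
  [/\ mdiff A 0 t 0 t = J t t, mdiff B 0 t 0 t = J t t, mdiff C 0 t 0 t = J t t &
   [/\ gap A B C 0 t t = 0, gap A B C t 0 t = 0 & gap A B C t t 0 = 0]].
  by move=> t01; split; [exact: JA|exact: JB|exact: JC|exact: gap_diag].
have [a1 a2 a3 [a4 a5 a6]] := E x x01; have [b1 b2 b3 [b4 b5 b6]] := E y y01.
have [c1 c2 c3 [c4 c5 c6]] := E z z01; have [d1 d2 d3 [d4 d5 d6]] := E 0 o01.
have := JA _ _ x01 y01; have := JB _ _ x01 z01; have := JC _ _ y01 z01.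
rewrite /diag_corrected /pot1 /pot2 /pot3 /mdiff /gap
  in a1 a2 a3 a4 a5 a6 b1 b2 b3 b4 b5 b6 c1 c2 c3 c4 c5 c6 d1 d2 d3 d4 d5 d6 *.
rewrite !J0l in d1 d2 d3.
by move=> h1 h2 h3; split; lra.
Qed.

End Potentials.

End Uniqueness.

(** * Structure of optimal triples *)

Section OptimalTriples.

Lemma int_sqE (G : R -> R -> R) : ucont2 G ->
  (\int[leb2 R]_(p in unit_sq R) (G p.1 p.2)%:E = (int_sq G)%:E)%E.
Proof.
move=> /ucont2_integrable iG; rewrite /int_sq fineK//.
by apply: integrable_fin_num iG; exact: measurable_sq.
Qed.

Lemma optimal_triple (J A B C : R -> R -> R) (F := diag_corrected J) :
  (forall y, J 0 y = 0) -> (forall x, 0 <= x -> J x 0 = 0) -> cell_bounded J ->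
  (forall x x' y y', 0 <= x <= 1 -> 0 <= x' <= 1 -> 0 <= y <= 1 -> 0 <= y' <= 1 ->
    `|J x' y' - J x y| <= `|x' - x| + `|y' - y|) ->
  ucont2 A -> ucont2 B -> ucont2 C ->
  (forall x y z, 0 <= x <= 1 -> 0 <= y <= 1 -> 0 <= z <= 1 -> 0 <= gap A B C x y z) ->
  int_sq F + int_sq F + int_sq F <= int_sq A + int_sq B + int_sq C ->
  exists f1 f2 f3 : R -> R, [/\ ucont1 f1, ucont1 f2, ucont1 f3 &
    forall x y z, 0 <= x <= 1 -> 0 <= y <= 1 -> 0 <= z <= 1 ->
    [/\ A x y = F x y + f1 x - f2 y, C y z = F y z + f2 y - f3 z &
        B x z = F x z + f3 z - f1 x]].
Proof.
move=> J0l J0r cJ dJ uA uB uC g0 le_int.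
have uF : ucont2 F := ucont2_diag_corrected _ dJ.
have glim := gsum_gap_lim _ _ _ _ J0l J0r cJ uF uA uB uC le_int.
have gS := gap_support _ _ _ uA uB uC g0 glim.
have cA := cell_bounded_of_gap _ _ _ g0 gS.
(* The support is invariant under permutations of the coordinates, so the argument for [A] applies
   to [B] and [C] with the roles exchanged. *)
have swap x y z : xor_support x y z -> xor_support x z y.
  move=> s d /s[q [i [j [iq jq [qd xi yj zk]]]]].
  exists q, i, (lxor i j); split => //; first exact: lxor_lt.
  by rewrite lxorK; split.
have rot x y z : xor_support x y z -> xor_support z x y.
  move=> s d /s[q [i [j [iq jq [qd xi yj zk]]]]].
  exists q, (lxor i j), i; split => //; first exact: lxor_lt.
  by rewrite (Nat.lxor_comm (lxor i j)) lxorK; split.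
have gapB x y z : gap B A (fun z y => C y z) x y z = gap A B C x z y.
  by rewrite /gap; ring.
have gapC x y z : gap C (fun y x => A x y) (fun z x => B x z) x y z = gap A B C z x y.
  by rewrite /gap; ring.
have cB : cell_bounded B.
  apply: (cell_bounded_of_gap B A (fun z y => C y z)) => x y z x01 y01 z01.
    by rewrite gapB g0.
  by move=> /swap s; rewrite gapB gS.
have cC : cell_bounded C.
  apply: (cell_bounded_of_gap C (fun y x => A x y) (fun z x => B x z)) => x y z x01 y01 z01.
    by rewrite gapC g0.
  by move=> /rot s; rewrite gapC gS.
have uJ : ucont2 J.
  apply: ucont2_lipschitz => x y x' y' x01 y01 x'01 y'01.
  apply: le_trans (dJ _ _ _ _ x'01 x01 y'01 y01) _.
  have := normr_ge0 (x - x'); have := normr_ge0 (y - y'); lra.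
have JE x y : 0 <= x <= 1 -> mdiff J 0 x 0 y = J x y.
  by move=> /andP[x0 _]; rewrite /mdiff !J0l (J0r _ x0) !(subr0, addr0).
have uniq G : cell_bounded G -> ucont2 G -> forall x y, 0 <= x <= 1 -> 0 <= y <= 1 ->
    mdiff G 0 x 0 y = J x y.
  by move=> cG uG x y x01 y01; rewrite (cell_bounded_unique _ _ cG cJ uG uJ)// JE.
have o01 : (0 : R) <= (0 : R) <= 1 by rewrite lexx ler01.
have c0 (x y : R) : `|(0 : R) - 0| <= `|x - y| by rewrite subrr normr0.
exists (pot1 J A), (pot2 J A), (pot3 J A B); split.
- by apply: ucont1_affine; [apply: ucont1_comp uA _ _ _ _|apply: ucont1_comp uJ _ _ _ _].
- by apply: ucont1_affine; [apply: (ucont1_comp _ (fun=> 0) id uA)|apply: ucont1_comp uJ _ _ _ _].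
- by apply: ucont1_affine; [apply: (ucont1_comp _ (fun=> 0) id uB)|apply: ucont1_comp uJ _ _ _ _].
move=> x y z x01 y01 z01.
apply: (potentials J A B C) => //; try by apply: uniq.
move=> t t01; have [s1 s2 s3] := xor_support_diag _ t01.
by split; apply: gS.
Qed.

End OptimalTriples.

End XorDuality.

Theorem mainTheorem18 (R : realType) (f12 f13 f23 : R -> R -> R) :
  {within unit_sq R, continuous (fun p => f12 p.1 p.2)} ->
  {within unit_sq R, continuous (fun p => f13 p.1 p.2)} ->
  {within unit_sq R, continuous (fun p => f23 p.1 p.2)} ->
  (forall x1 x2 x3 : R, x1 \in `[0, 1] -> x2 \in `[0, 1] -> x3 \in `[0, 1] ->
     f12 x1 x2 + f13 x1 x3 + f23 x2 x3 <= x1 * x2 * x3) ->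
  (forall g12 g13 g23 : R -> R -> R,
     (leb2 R).-integrable (unit_sq R) (fun p => (g12 p.1 p.2)%:E) ->
     (leb2 R).-integrable (unit_sq R) (fun p => (g13 p.1 p.2)%:E) ->
     (leb2 R).-integrable (unit_sq R) (fun p => (g23 p.1 p.2)%:E) ->
     (forall x1 x2 x3 : R, x1 \in `[0, 1] -> x2 \in `[0, 1] -> x3 \in `[0, 1] ->
        g12 x1 x2 + g13 x1 x3 + g23 x2 x3 <= x1 * x2 * x3) ->
     (\int[leb2 R]_(p in unit_sq R) (g12 p.1 p.2)%:E
      + \int[leb2 R]_(p in unit_sq R) (g13 p.1 p.2)%:E
      + \int[leb2 R]_(p in unit_sq R) (g23 p.1 p.2)%:E
      <= \int[leb2 R]_(p in unit_sq R) (f12 p.1 p.2)%:E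
      + \int[leb2 R]_(p in unit_sq R) (f13 p.1 p.2)%:E
      + \int[leb2 R]_(p in unit_sq R) (f23 p.1 p.2)%:E)%E) ->
  exists f1 f2 f3 : R -> R,
    [/\ {within `[0, 1], continuous f1},
        {within `[0, 1], continuous f2},
        {within `[0, 1], continuous f3} &
        forall x1 x2 x3 : R, x1 \in `[0, 1] -> x2 \in `[0, 1] -> x3 \in `[0, 1] ->
        [/\ f12 x1 x2 = fxor x1 x2 + f1 x1 - f2 x2,
            f23 x2 x3 = fxor x2 x3 + f2 x2 - f3 x3 &
            f13 x1 x3 = fxor x1 x3 + f3 x3 - f1 x1]].
Proof.
move=> c12 c13 c23 feas opt.
have u12 := ucont2_of_continuous R _ c12.
have u13 := ucont2_of_continuous R _ c13.
have u23 := ucont2_of_continuous R _ c23.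
have cJ : cell_bounded R (@Ixor R) by move=> n i j; exact: Ixor_cell.
have uF : ucont2 R (diag_corrected R (@Ixor R)) := ucont2_diag_corrected R _ (@Ixor_dist R).
have F_ge0 := gap_ge0 R _ (@Ixor0l R) (@Ixor0r R) cJ uF.
have iF := ucont2_integrable R _ uF.
have g0 x y z : 0 <= x <= 1 -> 0 <= y <= 1 -> 0 <= z <= 1 -> 0 <= gap R f12 f13 f23 x y z.
  move=> x01 y01 z01; rewrite /gap subr_ge0.
  by have := feas x y z; rewrite !in_itv/= => h; exact: h.
(* The triple made of [fxor] is feasible and integrable, so it is a competitor in the optimality
   hypothesis. *)
have le_int : int_sq R (diag_corrected R (@Ixor R)) + int_sq R (diag_corrected R (@Ixor R))
    + int_sq R (diag_corrected R (@Ixor R)) <= int_sq R f12 + int_sq R f13 + int_sq R f23.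
  rewrite -lee_fin !EFinD -!int_sqE//.
  apply: (opt _ _ _ iF iF iF) => x y z; rewrite !in_itv/= => x01 y01 z01.
  by have := F_ge0 _ _ _ x01 y01 z01; rewrite /gap subr_ge0.
have [f1 [f2 [f3 [cf1 cf2 cf3 fE]]]] := optimal_triple R (@Ixor R) f12 f13 f23
  (@Ixor0l R) (@Ixor0r R) cJ (@Ixor_dist R) u12 u13 u23 g0 le_int.
exists f1, f2, f3; split; try exact: within_continuous_of_ucont.
by move=> x y z; rewrite !in_itv/= => x01 y01 z01; exact: fE.
Qed.
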